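(* Let $\theta_i$ ($0\le i\le n$) be elements of the algebraic closure $\overline K$ of a valued field $(K,v)$ with respective minimal polynomials $\phi_i$ over $K$. If $\theta=\theta_n,\theta_{n-1},\ldots,\theta_0$ is a saturated distinguished chain for $\theta$, then the following conditions are satisfied: (i) $\Gamma_{\theta_i}=\Gamma_{\theta_{i-1}}+\mathbb Z\,\bar v(\phi_{i-1}(\theta_i))$ for $1\le i\le n$, and $\Gamma_{\theta_0}=\Gamma_v$; (ii) $k_{\theta_i}=k_{\theta_{i-1}}\left(\left(\frac{\phi_{i-1}(\theta_i)^{e_i}}{h_{i-1}(\theta_{i-1})}\right)^*\right)$ for $1\le i\le n$, where $e_i$ is the smallest positive integer such that $e_i\,\bar v(\phi_{i-1}(\theta_i))=\bar v(h_{i-1}(\theta_{i-1}))\in\Gamma_{\theta_{i-1}}$ for some $h_{i-1}\in K[x]$ with $\deg h_{i-1}<\deg\phi_{i-1}$, and $k_{\theta_0}=k_v$; (iii) $[K(\theta_i):K]=(\Gamma_{\theta_i}:\Gamma_v)\,[k_{\theta_i}:k_v]$ for $0\le i\le n$.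
   Context: $(K,v)$ is a valued field of arbitrary rank with value group $\Gamma_v$ and residue field $k_v$, $\overline K$ a fixed algebraic closure, $\bar v$ a fixed extension of $v$ to $\overline K$. For $\alpha\in\overline K$: $\deg\alpha=[K(\alpha):K]$; $\Gamma_\alpha$ and $k_\alpha$ are the value group and residue field of the restriction of $\bar v$ to $K(\alpha)$ (residue fields are regarded as subfields of the residue field of $\bar v$); for $a$ in the valuation ring of $\bar v$, $a^*$ denotes its residue. $(\theta,\alpha)\in\overline K^2$ is a $(K,v)$-distinguished pair if: $\deg\theta>\deg\alpha$; $\bar v(\theta-\alpha)=\max\{\bar v(\theta-\beta):\beta\in\overline K,\ \deg\beta<\deg\theta\}$; and $\bar v(\theta-\eta)<\bar v(\theta-\alpha)$ for every $\eta\in\overline K$ with $\deg\eta<\deg\alpha$. A chain $\theta=\theta_n,\theta_{n-1},\ldots,\theta_0$ of elements of $\overline K$ is a saturated distinguished chain for $\theta$ if $(\theta_{i+1},\theta_i)$ is a $(K,v)$-distinguished pair for $0\le i\le n-1$ and $\theta_0\in K$. *)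

(* Defs.v *)
From HB Require Import structures.
From mathcomp Require Import all_boot all_order all_algebra.
From mathcomp Require Import ring_quotient boolp classical_sets functions cardinality.

Set Implicit Arguments.
Unset Strict Implicit.
Unset Printing Implicit Defensive.

Import Order.TTheory GRing.Theory Num.Theory.
Local Open Scope classical_set_scope.
Local Open Scope card_scope.
Local Open Scope quotient_scope.
Local Open Scope ring_scope.

HB.mixin Record isOrderedGroup G of Num.POrderedZmodule G := {
  og_total : forall x y : G, (x <= y) || (y <= x);
  og_addl : forall z x y : G, x <= y -> z + x <= z + y
}.

#[short(type="orderedGroupType")]
HB.structure Definition OrderedGroup :=
  {G of Num.POrderedZmodule G & isOrderedGroup G}.

(** [option G] is [G] with a top element [None] adjoined, the value of [0]. *)
Section Infinity.
Variable G : orderedGroupType.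
Implicit Types a b : option G.

Definition vle a b : bool :=
  match a, b with
  | _, None => true
  | None, Some _ => false
  | Some x, Some y => x <= y
  end.

Definition vlt a b : bool := ~~ vle b a.

Definition vadd a b : option G :=
  match a, b with
  | Some x, Some y => Some (x + y)
  | _, _ => None
  end.

Definition vmin a b : option G := if vle a b then a else b.

Definition vmuln (n : nat) a : option G := iter n (vadd a) (Some 0).

Definition is_vmax (A : set (option G)) a : Prop :=
  A a /\ forall b, A b -> vle b a.

End Infinity.

Record valuation (F : fieldType) (G : orderedGroupType) := Valuation {
  val_fun :> F -> option G;
  val_infty : forall x, val_fun x = None <-> x = 0;
  valM : forall x y, val_fun (x * y) = vadd (val_fun x) (val_fun y);
  valD : forall x y, vle (vmin (val_fun x) (val_fun y)) (val_fun (x + y))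
}.

Section ResidueField.
Variables (F : fieldType) (G : orderedGroupType) (v : valuation F G).

Definition val_ring : {pred F} := fun x => vle (Some 0) (v x).

Lemma og_addr (z x y : G) : x <= y -> x + z <= y + z.
Proof. by move=> h; rewrite ![_ + z]addrC; apply: og_addl. Qed.

Lemma og_double0 (x : G) : x + x = 0 -> x = 0.
Proof.
move=> xx0; apply/le_anti/andP; case/orP: (og_total 0 x) => h; split=> //.
- by have := og_addl x _ _ h; rewrite xx0 addr0.
- by have := og_addl x _ _ h; rewrite xx0 addr0.
Qed.

Lemma val0 : v 0 = None. Proof. exact/val_infty. Qed.

Lemma val_neq0 x : x != 0 -> exists g, v x = Some g.
Proof.
case E: (v x) => [g|]; first by exists g.
by have /val_infty -> := E; rewrite eqxx.
Qed.

Lemma val1 : v 1 = Some 0.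
Proof.
have [g vg] := val_neq0 (oner_neq0 F).
have := valM v 1 1; rewrite mul1r vg /= => -[gg].
by congr Some; apply: (addrI g); rewrite -gg addr0.
Qed.

Lemma valN x : v (- x) = v x.
Proof.
have vN1 : v (-1) = Some 0.
  have [|g vg] := @val_neq0 (-1); first by rewrite oppr_eq0 oner_neq0.
  have := valM v (-1) (-1); rewrite mulrNN mul1r val1 vg /= => -[gg].
  by congr Some; apply: og_double0.
by rewrite -mulN1r valM vN1; case: (v x) => //= g; rewrite add0r.
Qed.

Lemma vle_trans (a b c : option G) : vle a b -> vle b c -> vle a c.
Proof. by case: a b c => [x|] [y|] [z|] //=; apply: le_trans. Qed.

Lemma vle_vmin (a b c : option G) : vle a b -> vle a c -> vle a (vmin b c).
Proof. by rewrite /vmin; case: ifP. Qed.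

Lemma val_ring_closed : subring_closed val_ring.
Proof.
split; first by rewrite unfold_in val1 /=.
- move=> x y; rewrite !unfold_in => vx vy.
  by apply: vle_trans (valD v x (- y)); apply: vle_vmin; rewrite ?valN.
- move=> x y; rewrite !unfold_in valM.
  case: (v x) (v y) => [a|] [b|] //= a0 b0.
  by apply: le_trans a0 _; rewrite -{1}[a]addr0; apply: og_addl.
Qed.

HB.instance Definition _ :=
  GRing.isSubringClosed.Build F val_ring val_ring_closed.

Record val_ring_type := ValRing { of_val_ring : F; _ : of_val_ring \in val_ring }.
HB.instance Definition _ := [isSub for of_val_ring].
HB.instance Definition _ := [Choice of val_ring_type by <:].
HB.instance Definition _ := [SubChoice_isSubComNzRing of val_ring_type by <:].

Definition val_ideal : {pred val_ring_type} := fun x => vlt (Some 0) (v (val x)).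

Lemma val_ideal_closed : idealr_closed val_ideal.
Proof.
have idN x : x \in val_ideal = vlt (Some 0) (v (val x)) by [].
split; first by rewrite idN /= val0.
  by rewrite idN /vlt rmorph1 val1 /= lexx.
move=> a x y; rewrite !idN rmorphD rmorphM /vlt => vx vy.
apply: contra (vle_trans (valD v _ _)) _.
rewrite valM /vmin; have := valP a; rewrite unfold_in.
case: ifP => _; last by move=> _; apply: contra vy.
case: (v (val a)) (v (val x)) vx => [b|] [c|] //= nc b0; apply: contra nc.
by apply: le_trans; rewrite -{1}[c]add0r; apply: og_addr.
Qed.

HB.instance Definition _ :=
  isIdealr.Build val_ring_type val_ideal val_ideal_closed.

Definition residue_type := {ideal_quot val_ideal}.

HB.instance Definition _ := Choice.on residue_type.
HB.instance Definition _ := GRing.ComNzRing.on residue_type.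

(* The inverse of the class of [x]; [x^-1] is in the valuation ring when [x] is
   a unit, and [insubd 0] sends it to [0] otherwise. *)
Definition residue_inv (a : residue_type) : residue_type :=
  \pi_residue_type (insubd 0 (val (repr a))^-1).

Lemma pi_residue_eq0 (x : val_ring_type) :
  (\pi_residue_type x == 0) = (x \in val_ideal).
Proof.
by rewrite -(rmorph0 (\pi_residue_type)) -Quotient.idealrBE subr0.
Qed.

Lemma residue_mulVf a : a != 0 -> residue_inv a * a = 1.
Proof.
rewrite -{1}[a]reprK pi_residue_eq0 /residue_inv; set x := repr a => xm.
have vx0 : v (val x) = Some 0.
  have := valP x; rewrite unfold_in; move: xm; rewrite unfold_in /vlt negbK.
  case: (v (val x)) => [g|] //= g0 g1.
  by congr Some; apply/le_anti; rewrite g0 g1.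
have x0 : val x != 0.
  by apply/eqP => /(val_infty v); rewrite vx0.
have vV : v (val x)^-1 = Some 0.
  have := valM v (val x)^-1 (val x); rewrite mulVf // val1 vx0.
  by case: (v _) => //= g [->]; rewrite addr0.
have xV : (val x)^-1 \in val_ring by rewrite unfold_in vV /=.
rewrite -[a in _ * a]reprK -/x -(rmorphM (\pi_residue_type)).
rewrite -(rmorph1 (\pi_residue_type)); congr (\pi_residue_type _).
by apply: val_inj; rewrite rmorphM rmorph1 /= insubdK // mulVf.
Qed.

Lemma residue_inv0 : residue_inv 0 = 0.
Proof.
rewrite /residue_inv; set x := repr 0.
have xm : x \in val_ideal by rewrite -pi_residue_eq0 reprK.
have [x0|x0] := eqVneq (val x) 0.
  rewrite x0 invr0; apply/eqP; rewrite pi_residue_eq0.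
  by rewrite unfold_in val_insubd; case: ifP; rewrite ?rmorph0 val0.
suff xV : (val x)^-1 \notin val_ring.
  rewrite /insubd insubN //=; apply/eqP; rewrite pi_residue_eq0.
  by rewrite unfold_in rmorph0 val0.
apply: contraL xm; rewrite !unfold_in /vlt negbK => xV.
have := valM v (val x)^-1 (val x); rewrite mulVf // val1.
case: (v (val x)) (v _^-1) xV => [g|] [h|] //= h0 [->].
by rewrite -{1}[g]add0r; apply: og_addr.
Qed.

HB.instance Definition _ :=
  GRing.ComNzRing_isField.Build residue_type residue_mulVf residue_inv0.

(* The residue [a^*]; [0] off the valuation ring. *)
Definition residue (x : F) : residue_type :=
  if insub x is Some a then \pi_residue_type (a : val_ring_type) else 0.

(* The value group and the residue field of the restriction of [v] to [E]. *)
Definition value_group (E : set F) : set G :=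
  [set g | exists2 x, E x & v x = Some g].

Definition residue_field (E : set F) : set residue_type :=
  [set residue x | x in E `&` [set x | x \in val_ring]].

End ResidueField.
Arguments residue_field {F G} v E.
Arguments residue {F G} v x.

Definition is_subfield (M : fieldType) (S : set M) : Prop :=
  divring_closed (mem S).

Definition adjoin (M : fieldType) (S : set M) (a : M) : set M :=
  smallest (@is_subfield M) (S `|` [set a]).

Definition is_basis (M : fieldType) (S E : set M) n (b : 'I_n -> M) : Prop :=
  [/\ forall i, E (b i),
      forall x, E x -> exists2 c : 'I_n -> M,
        (forall i, S (c i)) & x = \sum_(i < n) c i * b i
    & forall c : 'I_n -> M, (forall i, S (c i)) ->
        \sum_(i < n) c i * b i = 0 -> forall i, c i = 0].

(* [0] when [E] is not finite-dimensional over [S]. *)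
Definition field_degree (M : fieldType) (S E : set M) : nat :=
  xget 0%N [set n | exists b : 'I_n -> M, is_basis S E b].

(* [0] when the index is infinite. *)
Definition group_index (G : zmodType) (A B : set G) : nat :=
  xget 0%N [set n | [set [set a + b | b in B] | a in A] #= `I_n].

Section Chains.
Variables (K L : fieldType) (iota : {rmorphism K -> L}).

Definition is_algebraic_closure : Prop :=
  GRing.closed_field_axiom L /\ forall x : L, algebraicOver iota x.

Definition simple_ext (x : L) : set L := adjoin (range iota) x.

Definition deg (x : L) : nat := field_degree (range iota) (simple_ext x).

Definition ev (p : {poly K}) (x : L) : L := (map_poly iota p).[x].

Definition is_minpoly (x : L) (p : {poly K}) : Prop :=
  [/\ p \is monic, ev p x = 0
    & forall q : {poly K}, q != 0 -> ev q x = 0 -> (size p <= size q)%N].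

Variables (G : orderedGroupType) (vbar : valuation L G).

Definition distinguished_pair (theta alpha : L) : Prop :=
  [/\ (deg alpha < deg theta)%N,
      is_vmax [set vbar (theta - beta) | beta in
                 [set beta | (deg beta < deg theta)%N]]
              (vbar (theta - alpha))
    & forall eta : L, (deg eta < deg alpha)%N ->
        vlt (vbar (theta - eta)) (vbar (theta - alpha))].

Definition saturated_distinguished_chain (theta : L) (n : nat) (t : nat -> L) :=
  [/\ t n = theta,
      forall i, (i < n)%N -> distinguished_pair (t i.+1) (t i)
    & range iota (t 0%N)].

(* [e * vbar (phi x') = vbar (h x)] for a polynomial [h] over [K] with
   [deg h < deg phi], this value lying in the value group of [K(x)]. *)
Definition value_multiple (x x' : L) (phi : {poly K}) (e : nat) (h : {poly K}) :=
  [/\ (size h < size phi)%N,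
      vmuln e (vbar (ev phi x')) = vbar (ev h x)
    & exists2 g, value_group vbar (simple_ext x) g & vbar (ev h x) = Some g].

Definition least_multiplier (x x' : L) (phi : {poly K}) (e : nat) : Prop :=
  [/\ (0 < e)%N, exists h, value_multiple x x' phi e h
    & forall e', (0 < e')%N -> (exists h, value_multiple x x' phi e' h) ->
        (e <= e')%N].

End Chains.

(* Main.v *)
(* Let [(theta, alpha)] be a distinguished pair, [phi] the minimal polynomial of
   [alpha], [M = K(alpha)] and [pi = phi(theta)].  A polynomial [f] over [K] of
   degree less than [deg alpha] has all its roots farther from [theta] than
   [alpha] is, so [f(theta) / f(alpha)] has residue 1.  Let [E] be the order of
   [v(pi)] modulo the value group of [M], [v(pi ^ E) = v(c)] with [c] in [M],
   [y] the residue of [pi ^ E / c], and [N] the degree of [y] over the residue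
   field of [M].  For [a_i] in [M], the value of [\sum_(i < N * E) a_i pi ^ i] is
   the minimum of the values of its terms; applied to the expansion in powers of
   [phi] of the minimal polynomial of [theta], this gives
   [N * E * deg alpha <= deg theta].  Conversely, lift the minimal polynomial of
   [y] to a polynomial [g] over [K] of degree [N * E * deg alpha], with
   [v(g(theta)) > N v(c) = v(g(alpha))].  If [deg g < deg theta], then no root
   of [g] is closer to [theta] than [alpha] is, hence
   [v(g(theta)) <= v(g(alpha))], a contradiction.  Therefore
   [deg theta = N * E * deg alpha], every element of [K(theta)] is such a sum up
   to a factor of residue 1, and the value group and the residue field of
   [K(theta)] can be read off. *)
Require Import Defs.
From mathcomp Require Import all_boot all_order all_algebra.
From mathcomp Require Import boolp classical_sets functions cardinality.
From mathcomp Require Import ring.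
Import Order.TTheory GRing.Theory Num.Theory.
Local Open Scope classical_set_scope.
Local Open Scope ring_scope.

Set Implicit Arguments.
Unset Strict Implicit.
Unset Printing Implicit Defensive.

(** * Ordered groups with a top element *)

Section OrderedGroups.
Variable G : orderedGroupType.
Implicit Types (x y z : G) (a b c : option G).

Lemma og_lerD2r z x y : (x + z <= y + z) = (x <= y).
Proof.
apply/idP/idP => [h|]; last exact: og_addr.
by rewrite -[x](addrK z) -[y](addrK z); apply: og_addr.
Qed.

Lemma vle_refl : reflexive (@vle G).
Proof. by case=> //= x. Qed.

Lemma vle_total : total (@vle G).
Proof. by case=> [x|] [y|] //=; apply: og_total. Qed.

Lemma vle_transitive : transitive (@vle G).
Proof. by move=> b a c; apply: vle_trans. Qed.

Lemma vmuln_Some x n : vmuln n (Some x) = Some (x *+ n).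
Proof. by elim: n => //= n ->; rewrite /= mulrS. Qed.

End OrderedGroups.

(** * Valuations, residues, and units of residue 1 *)

Section Valuations.
Variables (F : fieldType) (G : orderedGroupType) (v : valuation F G).
Implicit Types x y z : F.

Definition val_max : {pred F} := fun x => vlt (Some 0) (v x).
(** The units of residue 1: multiplication by one of them preserves values, and residues of elements
    of the valuation ring. *)
Definition one_unit : {pred F} := fun x => x - 1 \in val_max.

Lemma vle_div x y : x != 0 -> vle (v x) (v y) = (y / x \in val_ring v).
Proof.
move=> x0; rewrite -{1}(divfK x0 y) Defs.valM unfold_in.
have [g ->] := val_neq0 v x0; case: (v (y / x)) => //= h.
by rewrite -{1}[g]add0r og_lerD2r.
Qed.

Lemma vlt_div x y : x != 0 -> vlt (v x) (v y) = (y / x \in val_max).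
Proof.
move=> x0; rewrite /vlt -{1}(divfK x0 y) Defs.valM unfold_in /vlt.
have [g ->] := val_neq0 v x0; case: (v (y / x)) => //= h.
by rewrite -{2}[g]add0r og_lerD2r.
Qed.

Lemma val_eq_div x y : y != 0 -> (v x = v y) <-> (v (x / y) = Some 0).
Proof.
move=> y0; rewrite -{1}(divfK y0 x) (Defs.valM v (x / y) y).
have [g ->] := val_neq0 v y0; case: (v (x / y)) => //= h; split=> [[]|[->]].
  by rewrite -{2}[g]add0r => /addIr ->.
by rewrite add0r.
Qed.

Lemma val_Some_neq0 x g : v x = Some g -> x != 0.
Proof. by move=> vx; apply/eqP => /(val_infty v); rewrite vx. Qed.

Lemma valV x g : v x = Some g -> v x^-1 = Some (- g).
Proof.
move=> vx; have x0 := val_Some_neq0 vx.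
have := Defs.valM v x^-1 x; rewrite mulVf // Defs.val1 vx.
case: (v x^-1) => //= h [e]; congr Some.
by apply: (addIr g); rewrite -e addNr.
Qed.

Lemma valX x n : v (x ^+ n) = vmuln n (v x).
Proof. by elim: n => [|n IH]; rewrite ?Defs.val1 // exprS Defs.valM IH. Qed.

Lemma vleM x y x' y' :
  vle (v x) (v y) -> vle (v x') (v y') -> vle (v (x * x')) (v (y * y')).
Proof.
rewrite !Defs.valM; case: (v x) (v y) (v x') (v y') => [a|] [b|] [c|] [d|] //=.
by move=> ab cd; apply: le_trans (og_addr c ab) (og_addl b _ _ cd).
Qed.

Lemma val_unit_ring x : v x = Some 0 -> x \in val_ring v.
Proof. by rewrite unfold_in => ->; rewrite /= lexx. Qed.

Lemma val_unitX x n : v x = Some 0 -> v (x ^+ n) = Some 0.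
Proof. by move=> vx; rewrite valX vx vmuln_Some mul0rn. Qed.

Lemma val_unitE x : x \in val_ring v -> (v x != Some 0) = (x \in val_max).
Proof.
rewrite !unfold_in /vlt; case: (v x) => [g|] //= g0; congr negb.
apply/eqP/idP => [[->]//|h]; congr Some; apply/le_anti.
by rewrite h.
Qed.

Lemma val_ring_max x : x \in val_max -> x \in val_ring v.
Proof. by rewrite !unfold_in /vlt; have := vle_total (Some 0) (v x); case: vle => //= ->. Qed.

Lemma residue_val (a : val_ring_type v) :
  residue v (val a) = (\pi_(residue_type v) a)%qT.
Proof. by rewrite /residue valK. Qed.

Lemma residueD x y : x \in val_ring v -> y \in val_ring v ->
  residue v (x + y) = residue v x + residue v y.
Proof.
move=> xO yO.
rewrite -[x]/(val (ValRing xO)) -[y]/(val (ValRing yO)) -rmorphD !residue_val.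
exact: (rmorphD (\pi_(residue_type v))%qT).
Qed.

Lemma residueM x y : x \in val_ring v -> y \in val_ring v ->
  residue v (x * y) = residue v x * residue v y.
Proof.
move=> xO yO.
rewrite -[x]/(val (ValRing xO)) -[y]/(val (ValRing yO)) -rmorphM !residue_val.
exact: (rmorphM (\pi_(residue_type v))%qT).
Qed.

Lemma residue1 : residue v 1 = 1.
Proof.
rewrite -(rmorph1 (val : val_ring_type v -> F)) residue_val.
exact: (rmorph1 (\pi_(residue_type v))%qT).
Qed.

Lemma residue0 : residue v 0 = 0.
Proof.
rewrite -(rmorph0 (val : val_ring_type v -> F)) residue_val.
exact: (rmorph0 (\pi_(residue_type v))%qT).
Qed.

Lemma residueN x : x \in val_ring v -> residue v (- x) = - residue v x.
Proof.
move=> xO.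
rewrite -[x]/(val (ValRing xO)) -rmorphN !residue_val.
exact: (rmorphN (\pi_(residue_type v))%qT).
Qed.

Lemma residueX x n : x \in val_ring v -> residue v (x ^+ n) = residue v x ^+ n.
Proof.
move=> xO; elim: n => [|n IH]; first by rewrite !expr0 residue1.
by rewrite !exprS residueM ?IH // rpredX.
Qed.

Lemma residue_sum I (r : seq I) (P : pred I) (f : I -> F) :
  (forall i, P i -> f i \in val_ring v) ->
  residue v (\sum_(i <- r | P i) f i) = \sum_(i <- r | P i) residue v (f i).
Proof.
move=> fO; elim: r => [|i r IH]; first by rewrite !big_nil residue0.
rewrite !big_cons; case: ifP => // Pi.
by rewrite residueD ?IH ?rpred_sum // fO.
Qed.

Lemma residue_eq0 x : x \in val_ring v -> (residue v x == 0) = (x \in val_max).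
Proof. by move=> xO; have := residue_val (ValRing xO) => /= ->; rewrite pi_residue_eq0. Qed.

Lemma residue_unit x : v x = Some 0 -> residue v x != 0.
Proof.
move=> vx; rewrite residue_eq0 ?val_unit_ring // -val_unitE ?val_unit_ring //.
by rewrite vx eqxx.
Qed.

Lemma residueV x : v x = Some 0 -> residue v x^-1 = (residue v x)^-1.
Proof.
move=> vx; have x0 := val_Some_neq0 vx.
have vV : v x^-1 = Some 0 by rewrite (valV vx) oppr0.
apply: (mulfI (residue_unit vx)).
by rewrite -residueM ?val_unit_ring // !divff ?residue1 ?residue_unit.
Qed.

Lemma val_maxP x : reflect (x \in val_ring v /\ residue v x = 0) (x \in val_max).
Proof.
apply: (iffP idP) => [xm|[xO /eqP]]; last by rewrite residue_eq0.
by split; [exact: val_ring_max | apply/eqP; rewrite residue_eq0 ?val_ring_max].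
Qed.

Lemma val_maxMl x y : x \in val_ring v -> y \in val_max -> x * y \in val_max.
Proof.
move=> xO /val_maxP[yO y0]; apply/val_maxP; split; first exact: rpredM.
by rewrite residueM // y0 mulr0.
Qed.

Lemma val_maxB x y : x \in val_max -> y \in val_max -> x - y \in val_max.
Proof.
move=> /val_maxP[xO x0] /val_maxP[yO y0]; apply/val_maxP; split; first exact: rpredB.
by rewrite residueD ?rpredN // residueN // x0 y0 subr0.
Qed.

Lemma val_max_sum I (r : seq I) (f : I -> F) :
  (forall i, f i \in val_max) -> \sum_(i <- r) f i \in val_max.
Proof.
move=> fm; apply/val_maxP; split; first by apply: rpred_sum => i _; apply: val_ring_max.
rewrite residue_sum => [|i _]; last exact: val_ring_max.
by apply: big1 => i _; have /val_maxP[] := fm i.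
Qed.

Lemma one_unitP x : reflect (x \in val_ring v /\ residue v x = 1) (x \in one_unit).
Proof.
apply: (iffP idP) => [/val_maxP[xO x0]|[xO x1]].
  have xO' : x \in val_ring v by rewrite -[x](subrK 1) rpredD ?rpred1.
  split=> //; apply/eqP; rewrite -subr_eq0 -x0.
  by rewrite residueD ?rpredN ?rpred1 // residueN ?rpred1 // residue1.
apply/val_maxP; split; first by rewrite rpredB ?rpred1.
by rewrite residueD ?rpredN ?rpred1 // residueN ?rpred1 // residue1 x1 subrr.
Qed.

Lemma one_unit_val x : x \in one_unit -> v x = Some 0.
Proof.
move=> /one_unitP[xO x1]; apply/eqP/negPn; rewrite val_unitE // -residue_eq0 //.
by rewrite x1 oner_neq0.
Qed.

Lemma one_unit1 : 1 \in one_unit.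
Proof. by apply/one_unitP; rewrite rpred1 residue1. Qed.

Lemma one_unitM x y : x \in one_unit -> y \in one_unit -> x * y \in one_unit.
Proof.
move=> /one_unitP[xO x1] /one_unitP[yO y1]; apply/one_unitP.
by rewrite rpredM // residueM // x1 y1 mulr1.
Qed.

Lemma one_unitV x : x \in one_unit -> x^-1 \in one_unit.
Proof.
move=> xU; have vx := one_unit_val xU; have /one_unitP[_ x1] := xU.
apply/one_unitP; rewrite residueV // x1 invr1; split=> //.
by apply: val_unit_ring; rewrite (valV vx) oppr0.
Qed.

Lemma val_mul_unit x u : v u = Some 0 -> v (x * u) = v x.
Proof. by move=> vu; rewrite Defs.valM vu; case: (v x) => //= g; rewrite addr0. Qed.

Lemma vle_argmin n (x : 'I_n -> F) : (0 < n)%N ->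
  exists i, forall j, vle (v (x i)) (v (x j)).
Proof.
case: n x => // n x _.
have [i _ h] := extremumP (fun i => v (x i)) (@vle_refl G) (@vle_transitive G)
  (@vle_total G) (isT : (fun=> true) (ord0 : 'I_n.+1)).
by exists i => j; apply: h.
Qed.

(* Dividing by a term of least value, only that term would survive in the
   residue field. *)
Lemma sum_eq0_val n (x : 'I_n -> F) i : \sum_j x j = 0 -> x i != 0 ->
  exists j k, [/\ j != k, x j != 0 & v (x j) = v (x k)].
Proof.
move=> s0 xi0; have n0 : (0 < n)%N by case: n i {s0 xi0} x => [[]|].
have [j jmin] := vle_argmin x n0.
have xj0 : x j != 0.
  apply: contraNneq xi0 => xj0; have := jmin i; rewrite xj0 val0.
  by case E: (v (x i)) => //= _; apply/eqP/(val_infty v).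
apply: contrapT => hn; suff : (1 : residue_type v) == 0 by rewrite oner_eq0.
have -> : 1 = residue v (\sum_k x k / x j).
  rewrite residue_sum => [|k _]; last by rewrite -vle_div.
  rewrite (bigD1 j) //= divff // residue1 big1 ?addr0 // => k kj.
  apply/eqP; rewrite residue_eq0 -?vle_div // -val_unitE -?vle_div //.
  apply/eqP => /(val_eq_div _ xj0) e; apply: hn.
  by exists j, k; split=> //; rewrite eq_sym.
by rewrite -mulr_suml s0 mul0r residue0.
Qed.

End Valuations.

(** * Subfields given as sets, their bases and degrees *)

Section SubfieldSets.
Variable M : fieldType.
Implicit Types (S E : set M) (x y : M).

(** Trades the boolean membership of [divring_closed] for the propositions [S x]. *)
Lemma is_subfieldP S : is_subfield S <->
  [/\ S 1, forall x y, S x -> S y -> S (x - y)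
    & forall x y, S x -> S y -> S (x / y)].
Proof.
have mS x : (x \in mem S) = `[< S x >] by [].
split=> [[S1 SB SV]|[S1 SB SV]]; split.
- by move: S1; rewrite mS => /asboolP.
- by move=> x y Sx Sy; have := SB x y; rewrite !mS => /(_ (asboolT Sx) (asboolT Sy)) /asboolP.
- by move=> x y Sx Sy; have := SV x y; rewrite !mS => /(_ (asboolT Sx) (asboolT Sy)) /asboolP.
- by rewrite mS; apply: asboolT.
- by move=> x y; rewrite !mS => /asboolP Sx /asboolP Sy; apply/asboolP/SB.
- by move=> x y; rewrite !mS => /asboolP Sx /asboolP Sy; apply/asboolP/SV.
Qed.

Section Closure.
Variable S : set M.
Hypothesis Ssub : is_subfield S.

Lemma subfield1 : S 1. Proof. by have /is_subfieldP[] := Ssub. Qed.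
Lemma subfieldB x y : S x -> S y -> S (x - y).
Proof. by have /is_subfieldP[_ h _] := Ssub; apply: h. Qed.
Lemma subfield_div x y : S x -> S y -> S (x / y).
Proof. by have /is_subfieldP[_ _] := Ssub; apply. Qed.
Lemma subfield0 : S 0.
Proof. by rewrite -(subrr 1); apply: subfieldB; apply: subfield1. Qed.
Lemma subfieldN x : S x -> S (- x).
Proof. by move=> Sx; rewrite -sub0r; apply: subfieldB => //; apply: subfield0. Qed.
Lemma subfieldD x y : S x -> S y -> S (x + y).
Proof. by move=> Sx Sy; rewrite -[y]opprK; apply/subfieldB/subfieldN. Qed.
Lemma subfieldV x : S x -> S x^-1.
Proof. by move=> Sx; rewrite -[_^-1]mul1r; apply: subfield_div => //; apply: subfield1. Qed.
Lemma subfieldM x y : S x -> S y -> S (x * y).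
Proof. by move=> Sx Sy; rewrite -[y]invrK; apply/subfield_div/subfieldV. Qed.
Lemma subfieldX x n : S x -> S (x ^+ n).
Proof.
by move=> Sx; elim: n => [|n IH]; [exact: subfield1 | rewrite exprS; apply: subfieldM].
Qed.
Lemma subfield_sum I (r : seq I) (f : I -> M) :
  (forall i, S (f i)) -> S (\sum_(i <- r) f i).
Proof.
move=> Sf; elim: r => [|i r IH]; first by rewrite big_nil; apply: subfield0.
by rewrite big_cons; apply: subfieldD.
Qed.

End Closure.

Lemma adjoin_min S E a : is_subfield E -> S `<=` E -> E a -> adjoin S a `<=` E.
Proof. by move=> Esub SE Ea; apply: smallest_sub => // x [/SE|->]. Qed.

Lemma adjoin_subfield S a : is_subfield (adjoin S a).
Proof.
apply/is_subfieldP; split=> [E [/is_subfieldP[]//]|x y Sx Sy E EE|x y Sx Sy E EE].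
  by have /is_subfieldP[_ h _] := EE.1; apply: h; [apply: Sx|apply: Sy].
by have /is_subfieldP[_ _ h] := EE.1; apply: h; [apply: Sx|apply: Sy].
Qed.

Lemma adjoin_sub S a : S `<=` adjoin S a.
Proof. by move=> x Sx E [_]; apply; left. Qed.

Lemma adjoin_gen S a : adjoin S a a.
Proof. by move=> E [_]; apply; right. Qed.

(** The two change-of-basis matrices multiply to the identity of size [n] through dimension [m],
    which forces [n <= m]. The product is the identity because each row of the difference is a
    relation among the [b j]. *)
Lemma basis_size_le S E n m (b : 'I_n -> M) (b' : 'I_m -> M) :
  is_subfield S -> is_basis S E b -> is_basis S E b' -> (n <= m)%N.
Proof.
move=> Ssub [Eb genb indb] [Eb' genb' _].
have /choice[C hC] i : exists c : 'I_m -> M,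
    (forall k, S (c k)) /\ b i = \sum_k c k * b' k.
  by have [c Sc e] := genb' _ (Eb i); exists c.
have /choice[D hD] k : exists c : 'I_n -> M,
    (forall j, S (c j)) /\ b' k = \sum_j c j * b j.
  by have [c Sc e] := genb _ (Eb' k); exists c.
suff /mulmx1_min : (\matrix_(i, k) C i k) *m (\matrix_(k, j) D k j) = 1%:M by [].
apply/matrixP => i j; apply/eqP; rewrite -subr_eq0; apply/eqP.
set A := _ *m _; have AE j' : A i j' = \sum_k C i k * D k j'.
  by rewrite mxE; apply: eq_bigr => k _; rewrite !mxE.
apply: (indb (fun j => A i j - (1%:M : 'M_n) i j)) => [j'|].
  apply: subfieldB => //; last first.
    by rewrite mxE; case: (i == j'); [apply: subfield1|apply: subfield0].
  rewrite AE; apply: subfield_sum => // k; apply: subfieldM => //.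
    by have [] := hC i.
  by have [] := hD k.
under eq_bigr do rewrite mulrBl.
rewrite sumrB; have -> : \sum_j (1%:M : 'M_n) i j * b j = b i.
  rewrite (bigD1 i) //= mxE eqxx mul1r big1 ?addr0 // => j' ij'.
  by rewrite mxE eq_sym (negbTE ij') mul0r.
apply/eqP; rewrite subr_eq0 (hC i).2; apply/eqP.
under eq_bigr do rewrite AE mulr_suml.
rewrite exchange_big /=; apply: eq_bigr => k _.
by rewrite (hD k).2 mulr_sumr; apply: eq_bigr => j' _; rewrite mulrA.
Qed.

Lemma field_degreeE S E n (b : 'I_n -> M) :
  is_subfield S -> is_basis S E b -> field_degree S E = n.
Proof.
move=> Ssub hb; rewrite /field_degree; case: xgetP => [m _ [b' hb']|/(_ n)[]]; last by exists b.
by apply/eqP; rewrite eqn_leq (basis_size_le Ssub hb hb') (basis_size_le Ssub hb' hb).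
Qed.

(** Allows bases indexed by pairs, although [is_basis] asks for ordinals. *)
Lemma is_basis_fin S E (I : finType) (b : I -> M) :
  (forall i, E (b i)) ->
  (forall x, E x -> exists2 c : I -> M, (forall i, S (c i)) & x = \sum_i c i * b i) ->
  (forall c : I -> M, (forall i, S (c i)) -> \sum_i c i * b i = 0 -> forall i, c i = 0) ->
  is_basis S E (fun k : 'I_#|I| => b (enum_val k)).
Proof.
move=> Eb genb indb; split=> // [x Ex|c Sc c0 k].
  have [c Sc ->] := genb x Ex; exists (fun k => c (enum_val k)) => //.
  by rewrite [LHS]big_enum_val.
have := indb (fun i => c (enum_rank i)) (fun i => Sc _).
rewrite [\sum_i _]big_enum_val /=.
under eq_bigr do rewrite enum_valK.
by move=> /(_ c0 (enum_val k)); rewrite enum_valK.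
Qed.

Lemma basis_tower S E1 E2 n m (b1 : 'I_n -> M) (b2 : 'I_m -> M) :
  is_subfield E1 -> is_subfield E2 -> S `<=` E1 -> E1 `<=` E2 ->
  is_basis S E1 b1 -> is_basis E1 E2 b2 ->
  exists b : 'I_(n * m) -> M, is_basis S E2 b.
Proof.
move=> E1sub E2sub SE1 E12 [Eb1 gen1 ind1] [Eb2 gen2 ind2].
have -> : (n * m)%N = #|{: 'I_n * 'I_m}| by rewrite card_prod !card_ord.
exists (fun k => b1 (enum_val k).1 * b2 (enum_val k).2).
apply: (is_basis_fin (b := fun p : 'I_n * 'I_m => b1 p.1 * b2 p.2)).
- by move=> p; apply: subfieldM => //; apply: E12.
- move=> x /gen2[c Ec ->].
  have /choice[d hd] j : exists d : 'I_n -> M,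
      (forall i, S (d i)) /\ c j = \sum_i d i * b1 i.
    by have [d Sd e] := gen1 _ (Ec j); exists d.
  exists (fun p => d p.2 p.1) => [p|]; first by have [] := hd p.2.
  rewrite -(pair_big xpredT xpredT (fun i j => d j i * (b1 i * b2 j))) exchange_big /=.
  apply: eq_bigr => j _; rewrite (hd j).2 mulr_suml.
  by apply: eq_bigr => i _; rewrite mulrA.
- move=> c Sc; rewrite (eq_bigr (fun p => c (p.1, p.2) * (b1 p.1 * b2 p.2))) => [|[]//].
  rewrite -(pair_big xpredT xpredT (fun i j => c (i, j) * (b1 i * b2 j))).
  rewrite exchange_big /= => c0 [i j].
  apply: (ind1 (fun i => c (i, j))) => // {i}.
  apply: (ind2 (fun j => \sum_i c (i, j) * b1 i)) => [{}j|].
    by apply: subfield_sum => // i; apply: subfieldM => //; apply: SE1.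
  rewrite -[RHS]c0; apply: eq_bigr => {}j _; rewrite mulr_suml.
  by apply: eq_bigr => i _; rewrite mulrA.
Qed.

End SubfieldSets.

(** * Coset representatives and the index of a subgroup *)

Section Transversals.
Variable G : zmodType.
Implicit Types A B : set G.

Definition subgroup_set B := B 0 /\ forall x y, B x -> B y -> B (x - y).

Lemma subgroup_setD B x y : subgroup_set B -> B x -> B y -> B (x + y).
Proof.
by move=> [B0 BB] Bx By; rewrite -[y]opprK; apply: (BB) => //; rewrite -sub0r; apply: BB.
Qed.

Lemma subgroup_setMz B x (m : int) : subgroup_set B -> B x -> B (x *~ m).
Proof.
move=> Bsub Bx; have Bn n : B (x *+ n).
  elim: n => [|n IH]; first exact: Bsub.1.
  by rewrite mulrS; apply: subgroup_setD.
case: m => n; first exact: Bn.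
by rewrite NegzE mulrNz -sub0r; apply: Bsub.2; [exact: Bsub.1|exact: Bn].
Qed.

(** Explicit representatives compose along a tower of groups, whereas [group_index] only records a
    cardinality picked by [xget]. *)
Definition coset_transversal A B (I : Type) (r : I -> G) :=
  [/\ forall i, A (r i), forall a, A a -> exists i, B (a - r i)
    & forall i j, B (r i - r j) -> i = j].

(** The cosets are in bijection with [I], so [xget] can only pick [#|I|]. *)
Lemma group_indexE A B (I : finType) (r : I -> G) :
  subgroup_set B -> coset_transversal A B r -> group_index A B = #|I|.
Proof.
move=> Bsub [Ar Agen rinj]; set coset := fun a : G => [set a + b | b in B].
have cosetE a a' : B (a - a') -> coset a = coset a'.
  move=> Baa; apply/seteqP; split=> _ [b Bb <-].
    by exists (a - a' + b); [exact: subgroup_setD|rewrite addrA [a' + _]addrC subrK].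
  exists (b - (a - a')); first exact: Bsub.2.
  by rewrite opprB [b + _]addrC addrA (addrC a) subrK.
have cosetI a a' : coset a = coset a' -> B (a - a').
  move=> e; have : coset a a by exists 0; [exact: Bsub.1|rewrite addr0].
  by rewrite e => -[b Bb <-]; rewrite addrAC subrr add0r.
have -> : group_index A B = xget 0%N [set n | [set coset a | a in A] #= `I_n]%card by [].
have card : ([set coset a | a in A] #= `I_#|I|)%card.
  have -> : [set coset a | a in A] = [set coset (r (enum_val k)) | k in [set: 'I_#|I|]].
    apply/seteqP; split=> _ [a Aa <-]; last by exists (r (enum_val a)).
    have [i Bi] := Agen a Aa; exists (enum_rank i) => //.
    by rewrite enum_rankK; apply/esym/cosetE.
  rewrite (card_eqr card_II); apply: inj_card_eq => k k' _ _ /cosetI/rinj.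
  exact: enum_val_inj.
case: xgetP => [n _ cardn|/(_ _ card)//].
apply/card_eq_II; rewrite -(card_eql cardn).
exact: card.
Qed.

Lemma transversal_trans A1 A2 B (I J : Type) (r : I -> G) (s : J -> G) :
  subgroup_set A1 -> subgroup_set A2 -> B `<=` A1 -> A1 `<=` A2 ->
  coset_transversal A1 B r -> coset_transversal A2 A1 s ->
  coset_transversal A2 B (fun p : I * J => r p.1 + s p.2).
Proof.
move=> A1sub A2sub BA1 A12 [Ar genr injr] [As gens injs]; split=> [p|a Aa|[i j] [i' j'] /=].
- by apply: subgroup_setD => //; apply: A12.
- have [j Aj] := gens a Aa; have [i Bi] := genr _ Aj.
  by exists (i, j); rewrite /= [r i + _]addrC opprD addrA.
- move=> Bd; have dE : r i + s j - (r i' + s j') = (r i - r i') + (s j - s j').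
    by rewrite opprD addrACA.
  have jj' : j = j'.
    (* [s j - s j'] is the given element of [B] minus [r i - r i'], and both lie in [A1]. *)
    apply: injs; rewrite -[_ - _](addKr (r i - r i')) -dE addrC.
    apply: A1sub.2; [exact: BA1|exact: A1sub.2].
  by subst j'; congr pair; apply: injr; move: Bd; rewrite dE subrr addr0.
Qed.

End Transversals.

(** * Sums of powers of one element with coefficients in a subfield *)

Lemma sum_ord_mul (V : nmodType) (f : nat -> V) n m :
  \sum_(k < n * m) f k = \sum_(j < n) \sum_(s < m) f (j * m + s)%N.
Proof.
elim: n => [|n IH]; first by rewrite !big_ord0.
by rewrite big_ord_recr /= -IH mulSn addnC big_split_ord.
Qed.

(** When [p ^+ E] and [c] have equal value, this isolates the class [s] of the exponent modulo [E]:
    [c ^+ j] joins the coefficient and the last factor is a unit. *)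
Lemma power_split (F : fieldType) (a p c : F) E j s : c != 0 ->
  a * p ^+ (j * E + s) = a * c ^+ j * p ^+ s * (p ^+ E / c) ^+ j.
Proof.
move=> c0; rewrite exprD mulnC exprM; move: (p ^+ E) => q.
by rewrite expr_div_n; field; rewrite expf_neq0.
Qed.

Section ResidueSets.
Variables (F : fieldType) (G : orderedGroupType) (v : valuation F G).
Variable S : set F.
Hypothesis Ssub : is_subfield S.

Lemma residue_field_subfield : is_subfield (residue_field v S).
Proof.
apply/is_subfieldP; split.
- by exists 1; [split; [exact: subfield1|exact: rpred1]|exact: residue1].
- move=> _ _ [x [Sx xO] <-] [y [Sy yO] <-]; exists (x - y).
    by split; [exact: subfieldB|exact: rpredB].
  by rewrite residueD ?rpredN // residueN.
- move=> _ _ [x [Sx xO] <-] [y [Sy yO] <-].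
  have [vy|] := eqVneq (v y) (Some 0).
    have yVO : y^-1 \in val_ring v by apply: val_unit_ring; rewrite (valV vy) oppr0.
    exists (x / y); last by rewrite residueM // residueV.
    by split; [exact: subfield_div|exact: rpredM].
  (* A non-unit of the valuation ring has residue 0, and the inverse of 0 is 0 by convention. *)
  rewrite val_unitE // -residue_eq0 // => /eqP ->; rewrite invr0 mulr0.
  by exists 0; [split; [exact: subfield0|exact: rpred0]|exact: residue0].
Qed.

Lemma value_group_subgroup : subgroup_set (value_group v S).
Proof.
split=> [|g h [x Sx vx] [y Sy vy]]; first by exists 1; [exact: subfield1|rewrite Defs.val1].
by exists (x / y); [exact: subfield_div|rewrite Defs.valM vx (valV vy)].
Qed.

Variables (p c : F) (E : nat).
Hypotheses (p0 : p != 0) (E0 : (0 < E)%N) (Sc : S c) (vc : v c = v (p ^+ E)).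
Hypothesis Emin : forall j, (0 < j < E)%N -> forall x, S x -> v x <> v (p ^+ j).

Let y := residue v (p ^+ E / c).

Let c0 : c != 0.
Proof.
have [g vpE] := val_neq0 v (expf_neq0 E p0).
by apply: (@val_Some_neq0 _ _ v _ g); rewrite vc.
Qed.

Let vu : v (p ^+ E / c) = Some 0. Proof. exact/val_eq_div. Qed.

(** If [s < r], then [a / b] is an element of [S] with the value of [p ^+ (r - s)], against the
    minimality of [E]. *)
Lemma power_value_class a b s r : S a -> S b -> a != 0 -> b != 0 ->
  (s < E)%N -> (r < E)%N -> v (a * p ^+ s) = v (b * p ^+ r) -> s = r.
Proof.
wlog sr : a b s r / (s <= r)%N => [hw Sa Sb a0 b0 sE rE vab|].
  case/orP: (leq_total s r) => h; first exact: hw h Sa Sb a0 b0 sE rE vab.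
  by apply/esym; exact: hw h Sb Sa b0 a0 rE sE (esym vab).
move=> Sa Sb a0 b0 sE rE vab; apply/eqP; rewrite eqn_leq sr leqNgt.
apply/negP => ltsr; have := @Emin (r - s)%N _ (a / b) (subfield_div Ssub Sa Sb).
rewrite subn_gt0 ltsr (leq_ltn_trans (leq_subr _ _) rE) => /(_ isT); apply.
apply/val_eq_div; first exact: expf_neq0.
have := vab; rewrite -{1}(subnKC sr) exprD => /val_eq_div.
rewrite !mulf_neq0 ?expf_neq0 // => /(_ isT) <-; congr (v _).
by field; rewrite b0 !expf_neq0.
Qed.

(* The terms whose exponent lies in the residue class of a term of least value
   are the only ones to survive in the residue field after division by it, and
   there they form a nontrivial polynomial in [y]. *)
Lemma val_expansion N (a : nat -> F) :
  (forall d : 'I_N -> residue_type v, (forall j, residue_field v S (d j)) ->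
     \sum_(j < N) d j * y ^+ j = 0 -> forall j, d j = 0) ->
  (forall i, S (a i)) ->
  forall i, (i < N * E)%N ->
    vle (v (\sum_(k < N * E) a k * p ^+ k)) (v (a i * p ^+ i)).
Proof.
move=> indy Sa i iNE.
have [i0 i0min] := vle_argmin v (fun k : 'I_(N * E) => a k * p ^+ k)
  (leq_ltn_trans (leq0n i) iNE).
apply: vle_trans (i0min (Ordinal iNE)).
have [->|ai0] := eqVneq (a i0) 0; first by rewrite mul0r val0; case: (v _).
apply/negPn/negP => hlt.
set r := (i0 %% E)%N; set j0 := (i0 %/ E)%N.
have j0N : (j0 < N)%N by rewrite ltn_divLR.
have rE : (r < E)%N by rewrite ltn_mod.
pose D := a i0 * c ^+ j0 * p ^+ r.
have D0 : D != 0 by rewrite !mulf_neq0 ?expf_neq0.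
have vD : v (a i0 * p ^+ i0) = v D.
  by rewrite {2}(divn_eq i0 E) (power_split _ _ _ _ _ c0) val_mul_unit ?val_unitX.
pose T k := a k * p ^+ k / D.
pose d j := a (j * E + r)%N * c ^+ j / (a i0 * c ^+ j0).
have Sd j : S (d j).
  by apply: subfield_div => //; apply: subfieldM => //; apply: subfieldX.
have Tr j : T (j * E + r)%N = d j * (p ^+ E / c) ^+ j.
  by rewrite /T (power_split _ _ _ _ _ c0) /d /D; field; rewrite ai0 !expf_neq0.
have TO k : (k < N * E)%N -> T k \in val_ring v.
  by move=> kN; rewrite -vle_div // -vD; apply: (i0min (Ordinal kN)).
have rN j : (j < N)%N -> forall s, (s < E)%N -> (j * E + s < N * E)%N.
  by move=> jN s sE; apply: leq_trans (leq_mul jN (leqnn E)); rewrite mulSn addnC ltn_add2r.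
have dO j : (j < N)%N -> d j \in val_ring v.
  move=> jN; have := TO _ (rN j jN r rE); rewrite Tr unfold_in.
  by rewrite val_mul_unit ?val_unitX.
have uO : p ^+ E / c \in val_ring v by apply: val_unit_ring.
have resT j s : (j < N)%N -> (s < E)%N -> residue v (T (j * E + s)%N) =
    if s == r then residue v (d j) * y ^+ j else 0.
  move=> jN sE; have [->|sr] := eqVneq s r.
    by rewrite Tr residueM ?residueX ?rpredX // dO.
  apply/eqP; rewrite residue_eq0 ?TO ?rN // -val_unitE ?TO ?rN //.
  apply: contraNneq sr => /(val_eq_div v _ D0).
  rewrite (power_split _ _ _ _ _ c0) val_mul_unit ?val_unitX //.
  have [->|ak0] := eqVneq (a (j * E + s)%N) 0.
    by rewrite !mul0r val0 => /esym/val_infty/eqP; rewrite (negbTE D0).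
  move=> /power_value_class -> //; rewrite ?mulf_neq0 ?expf_neq0 //; apply: subfieldM => //.
    exact: subfieldX.
  exact: subfieldX.
have sumT : \sum_(j < N) residue v (d j) * y ^+ j = 0.
  transitivity (residue v (\sum_(k < N * E) T k)); last first.
    apply/eqP; rewrite residue_eq0; last by apply: rpred_sum => k _; apply: TO.
    by rewrite -mulr_suml -vlt_div // -vD.
  rewrite residue_sum => [|k _]; last exact: TO.
  rewrite (sum_ord_mul (fun k => residue v (T k))); apply: eq_bigr => j _.
  rewrite (bigD1 (Ordinal rE)) //= resT // eqxx big1 ?addr0 // => s sr.
  by rewrite resT // ifN.
(* The coefficient [d j0] is 1, so the relation just found is not trivial. *)
have /eqP := indy (fun j => residue v (d j)) (fun j => ex_intro2 _ _ (d j)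
  (conj (Sd j) (dO j (ltn_ord j))) erefl) sumT (Ordinal j0N).
rewrite /d /= -divn_eq divff ?residue1 ?oner_eq0 //.
by rewrite mulf_neq0 ?expf_neq0.
Qed.

End ResidueSets.

(** * Roots, minimal polynomials and simple extensions in an algebraic closure *)

Lemma basis1 (M : fieldType) (S : set M) :
  is_subfield S -> is_basis S S (fun _ : 'I_1 => 1).
Proof.
move=> Ssub; split=> [i|x Sx|c Sc]; first exact: subfield1.
  by exists (fun=> x) => //; rewrite big_ord1 mulr1.
by rewrite big_ord1 mulr1 => c0 i; rewrite ord1.
Qed.

Lemma closed_field_factor (L : fieldType) (p : {poly L}) :
  GRing.closed_field_axiom L -> p != 0 ->
  exists s : seq L, p = lead_coef p *: \prod_(z <- s) ('X - z%:P).
Proof.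
move=> Lcl; have [n] := ubnP (size p); elim: n p => // n IH p; rewrite ltnS => pn p0.
have [p1|p1] := leqP (size p) 1.
  exists [::]; rewrite big_nil alg_polyC; have e := size1_polyC p1.
  by rewrite {1}e; congr (_%:P); rewrite e lead_coefC coefC.
have [z rz] : exists z, root p z.
  have p2 : (0 < (size p).-1)%N by rewrite -subn1 subn_gt0.
  (* The axiom solves [z ^+ n = \sum_(i < n) P i * z ^+ i]; here [P] holds the negated lower
     coefficients of [p] divided by the leading one. *)
  have [z hz] := Lcl _ (fun i => - (p`_i / lead_coef p)) p2.
  exists z; rewrite rootE horner_coef -(prednK (ltnW p1)) big_ord_recr /= hz.
  rewrite mulr_sumr -big_split big1 // => i _ /=.
  have := p0; rewrite -lead_coef_eq0 lead_coefE => l0.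
  by rewrite mulNr mulrN [_ * (_ / _ * _)]mulrA mulrCA divff // mulr1 subrr.
have /factor_theorem[q pE] := rz.
have q0 : q != 0 by apply: contraNneq p0 => q0; rewrite pE q0 mul0r.
have sq : (size q < n)%N.
  by move: pn; rewrite pE size_Mmonic ?monicXsubC // size_XsubC addn2.
have [s qE] := IH q sq q0; exists (z :: s).
by rewrite big_cons {1}pE {1}qE pE lead_coef_Mmonic ?monicXsubC // -scalerAl mulrC.
Qed.

Section SimpleExtensions.
Variables (K L : fieldType) (iota : {rmorphism K -> L}).
Hypothesis HL : is_algebraic_closure iota.
Implicit Types (x y z : L) (f p q : {poly K}).

Local Notation ev := (ev iota).

Lemma evD p q x : ev (p + q) x = ev p x + ev q x.
Proof. by rewrite /Defs.ev rmorphD hornerD. Qed.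
Lemma evN p x : ev (- p) x = - ev p x.
Proof. by rewrite /Defs.ev rmorphN hornerN. Qed.
Lemma evM p q x : ev (p * q) x = ev p x * ev q x.
Proof. by rewrite /Defs.ev rmorphM hornerM. Qed.
Lemma evX p x n : ev (p ^+ n) x = ev p x ^+ n.
Proof. by rewrite /Defs.ev rmorphXn horner_exp. Qed.
Lemma evC a x : ev a%:P x = iota a.
Proof. by rewrite /Defs.ev map_polyC hornerC. Qed.
Lemma evZ a p x : ev (a *: p) x = iota a * ev p x.
Proof. by rewrite -mul_polyC evM evC. Qed.
Lemma ev_id x : ev 'X x = x.
Proof. by rewrite /Defs.ev map_polyX hornerX. Qed.
Lemma ev0 x : ev 0 x = 0.
Proof. by rewrite /Defs.ev rmorph0 horner0. Qed.
Lemma ev_comp p q x : ev (p \Po q) x = ev p (ev q x).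
Proof. by rewrite /Defs.ev map_comp_poly horner_comp. Qed.
Lemma ev_sum I (r : seq I) (P : pred I) (g : I -> {poly K}) x :
  ev (\sum_(i <- r | P i) g i) x = \sum_(i <- r | P i) ev (g i) x.
Proof. by rewrite /Defs.ev rmorph_sum horner_sum. Qed.
Lemma ev_coef p x n : (size p <= n)%N -> ev p x = \sum_(i < n) iota p`_i * x ^+ i.
Proof.
move=> pn; rewrite /Defs.ev (@horner_coef_wide _ n) ?size_map_poly //.
by apply: eq_bigr => i _; rewrite coef_map.
Qed.

(** Turns estimates on the differences [x - z] into estimates on [ev f x]; the last clause is there
    to bound the degrees of the [z]. *)
Lemma ev_factor f : f != 0 -> exists (c : L) (s : seq L),
  [/\ c != 0, forall x, ev f x = c * \prod_(z <- s) (x - z)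
    & forall z, z \in s -> ev f z = 0].
Proof.
move=> f0; have f0' : map_poly iota f != 0 by rewrite map_poly_eq0.
have [s fE] := closed_field_factor HL.1 f0'.
have fE' x : ev f x = lead_coef (map_poly iota f) * \prod_(z <- s) (x - z).
  rewrite /Defs.ev {1}fE hornerZ horner_prod; congr (_ * _).
  by apply: eq_bigr => z _; rewrite hornerXsubC.
exists (lead_coef (map_poly iota f)), s; split=> //; first by rewrite lead_coef_eq0.
move=> z zs; rewrite fE'; apply/eqP; rewrite mulf_eq0 prodf_seq_eq0.
by apply/orP; right; apply/hasP; exists z; rewrite ?subrr /=.
Qed.

Lemma minpoly_exists x : exists p, is_minpoly iota x p.
Proof.
pose P n := `[< exists p, [/\ p != 0, ev p x = 0 & size p = n] >].
have exP : exists n, P n.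
  have [p p0 /rootP px] := HL.2 x; exists (size p); apply/asboolP; exists p.
  by split.
case: (ex_minnP exP) => n /asboolP[p [p0 px pn]] nmin.
exists ((lead_coef p)^-1 *: p); split.
- by rewrite monicE lead_coefZ mulVf ?lead_coef_eq0.
- by rewrite evZ px mulr0.
- move=> q q0 qx; rewrite size_scale ?invr_eq0 ?lead_coef_eq0 // pn.
  by apply: nmin; apply/asboolP; exists q.
Qed.

Lemma minpoly_small x p q : is_minpoly iota x p -> (size q < size p)%N ->
  ev q x = 0 -> q = 0.
Proof.
move=> [_ _ pmin] qp qx; apply/eqP/negPn/negP => q0.
by have := pmin q q0 qx; rewrite leqNgt qp.
Qed.

Lemma range_subfield : is_subfield (range iota).
Proof.
apply/is_subfieldP; split=> [|_ _ [a _ <-] [b _ <-]|_ _ [a _ <-] [b _ <-]].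
- by exists 1; rewrite ?rmorph1.
- by exists (a - b); rewrite ?rmorphB.
- by exists (a / b); rewrite ?fmorph_div.
Qed.

Lemma simple_ext_subfield x : is_subfield (simple_ext iota x).
Proof. exact: adjoin_subfield. Qed.

Lemma simple_ext_range x : range iota `<=` simple_ext iota x.
Proof. exact: adjoin_sub. Qed.

Lemma simple_ext_iota x a : simple_ext iota x (iota a).
Proof. by apply: simple_ext_range; exists a. Qed.

Lemma simple_ext_ev x q : simple_ext iota x (ev q x).
Proof.
have xsub := simple_ext_subfield x.
rewrite (ev_coef _ (leqnn _)); apply: (subfield_sum xsub) => i.
apply: (subfieldM xsub); first exact: simple_ext_iota.
by apply: (subfieldX xsub); apply: adjoin_gen.
Qed.

(** The minimal polynomial of [y] is [r * 'X + c] with [c] nonzero, as otherwise [r] would already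
    vanish at [y]. Hence [r(y) * y = - c], and the inverse of [y] is [- r(y) / c]. *)
Lemma evV q x : exists p, ev p x = (ev q x)^-1.
Proof.
set y := ev q x; have [y0|y0] := eqVneq y 0.
  by exists 0; rewrite ev0 y0 invr0.
have [r [rmon ry rmin]] := minpoly_exists y.
elim/poly_ind: r rmon ry rmin => [|r c _ rmon ry rmin].
  by move=> /monic_neq0; rewrite eqxx.
have rE := ry; rewrite evD evM ev_id evC in rE.
have c0 : c != 0.
  apply/negP => /eqP c0; move: rE rmin rmon; rewrite c0 rmorph0 !addr0 => /eqP.
  rewrite mulf_eq0 (negbTE y0) orbF => /eqP ry0 rmin rmon.
  have r0 : r != 0.
    by apply: contraTneq rmon => ->; rewrite mul0r monicE lead_coef0 eq_sym oner_eq0.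
  by have := rmin r r0 ry0; rewrite size_mulX // ltnn.
exists (((- c^-1) *: r) \Po q); rewrite ev_comp evZ -/y rmorphN fmorphV.
have ic0 : iota c != 0 by rewrite fmorph_eq0.
apply: (mulIf y0); rewrite mulVf // -mulrA.
move/eqP: rE; rewrite addr_eq0 => /eqP ->.
by rewrite mulrNN mulVf.
Qed.

(** The polynomial values at [x] already form a field, their inverses being polynomial values by
    [evV]. *)
Lemma simple_extE x : simple_ext iota x = [set ev q x | q in [set: {poly K}]].
Proof.
apply/seteqP; split=> [|_ [q _ <-]]; last exact: simple_ext_ev.
apply: adjoin_min; last by exists 'X; rewrite ?ev_id.
  apply/is_subfieldP; split=> [|_ _ [p _ <-] [q _ <-]|_ _ [p _ <-] [q _ <-]].
  - by exists 1%:P; rewrite ?evC ?rmorph1.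
  - by exists (p - q); rewrite ?evD ?evN.
  - by have [r rE] := evV q x; exists (p * r); rewrite ?evM ?rE.
by move=> _ [a _ <-]; exists a%:P; rewrite ?evC.
Qed.

Lemma simple_extP x p y : is_minpoly iota x p -> simple_ext iota x y ->
  exists2 q : {poly K}, (size q < size p)%N & y = ev q x.
Proof.
move=> [pmon px _]; rewrite simple_extE => -[q _ <-]; exists (q %% p).
  by rewrite ltn_modp monic_neq0.
by rewrite {1}(divp_eq q p) evD evM px mulr0 add0r.
Qed.

Lemma minpoly_size_gt1 x p : is_minpoly iota x p -> (1 < size p)%N.
Proof.
move=> [pmon px _]; rewrite ltnNge; apply/negP => /size1_polyC pE.
have := monic_neq0 pmon; move: px; rewrite pE evC => /eqP.
by rewrite fmorph_eq0 => /eqP ->; rewrite eqxx.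
Qed.

Lemma deg_minpoly x p : is_minpoly iota x p -> size p = (deg iota x).+1.
Proof.
move=> hp; have p1 := minpoly_size_gt1 hp; have sp := prednK (ltnW p1).
suff -> : deg iota x = (size p).-1 by [].
apply: (field_degreeE (b := fun i : 'I_(size p).-1 => x ^+ i) range_subfield).
split=> [i|y|c Sc].
- by apply: (subfieldX (simple_ext_subfield x)); apply: adjoin_gen.
- move=> /(simple_extP hp)[q]; rewrite -sp ltnS => qp ->.
  by exists (fun i => iota q`_i) => [i|]; [exists q`_i|exact: ev_coef].
- have /choice[a ha] : forall i, exists a, iota a = c i.
    by move=> i; have [a _ e] := Sc i; exists a.
  (* The coefficients, known only on ordinals, are extended by 0 to all naturals. *)
  pose q := \poly_(i < (size p).-1) oapp a 0 (insub i).
  have qE (i : 'I_(size p).-1) : q`_i = a i by rewrite coef_poly ltn_ord valK.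
  have sq : (size q <= (size p).-1)%N by exact: size_poly.
  move=> c0 i; rewrite -ha -qE; suff -> : q = 0 by rewrite coef0 rmorph0.
  apply: (minpoly_small hp); first by rewrite -sp ltnS.
  by rewrite (ev_coef _ sq) -[RHS]c0; apply: eq_bigr => j _; rewrite qE ha.
Qed.

Lemma deg_gt0 x : (0 < deg iota x)%N.
Proof.
have [p hp] := minpoly_exists x.
by have := minpoly_size_gt1 hp; rewrite (deg_minpoly hp).
Qed.

Lemma deg_root f x : f != 0 -> ev f x = 0 -> (deg iota x < size f)%N.
Proof.
have [p hp] := minpoly_exists x => f0 fx.
by rewrite -(deg_minpoly hp); have [_ _] := hp; apply.
Qed.

Lemma simple_ext_base x : range iota x -> simple_ext iota x = range iota.
Proof.
move=> xK; apply/seteqP; split; last exact: simple_ext_range.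
by apply: adjoin_min => //; exact: range_subfield.
Qed.

End SimpleExtensions.

(** Digits in base [phi] by repeated Euclidean division, the remainder being the lowest one;
    [(size phi).-1] is the degree of [phi]. *)
Lemma poly_expansion (K : fieldType) (phi f : {poly K}) N : (1 < size phi)%N ->
  (size f <= N * (size phi).-1)%N ->
  exists g : nat -> {poly K}, (forall i, (size (g i) < size phi)%N)
    /\ f = \sum_(i < N) g i * phi ^+ i.
Proof.
move=> p1; have p0 : phi != 0 by apply: contraTneq p1 => ->; rewrite size_poly0.
have sp := prednK (ltnW p1).
elim: N f => [|N IH] f.
  rewrite mul0n leqn0 size_poly_eq0 => /eqP ->; exists (fun=> 0).
  by split=> [i|]; rewrite ?big_ord0 // size_poly0 ltnW.
move=> fN; have [|g [gs gE]] := IH (f %/ phi).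
  by rewrite size_divp // leq_subLR -mulSn.
exists (fun i => if i is j.+1 then g j else f %% phi); split=> [[|i]//|].
  by rewrite ltn_modp.
rewrite big_ord_recl expr0 mulr1 {1}(divp_eq f phi) {1}gE addrC mulr_suml.
by congr (_ + _); apply: eq_bigr => i _; rewrite exprSr mulrA.
Qed.

(** * Comparison of values at the two members of a distinguished pair *)

Section DistinguishedPair.
Variables (K L : fieldType) (iota : {rmorphism K -> L}).
Hypothesis HL : is_algebraic_closure iota.
Variables (G : orderedGroupType) (v : valuation L G) (theta alpha : L).
Hypothesis pair : distinguished_pair iota v theta alpha.
Variable phi : {poly K}.
Implicit Type f : {poly K}.
Hypothesis phi_min : is_minpoly iota alpha phi.

Local Notation ev := (ev iota).
Let M := simple_ext iota alpha.
Let T := simple_ext iota theta.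
Let pi := ev phi theta.

Let Msub : is_subfield M. Proof. exact: simple_ext_subfield. Qed.
Let Tsub : is_subfield T. Proof. exact: simple_ext_subfield. Qed.

(** Root by root: a root [z] has degree below [deg alpha], so the third condition on the pair makes
    [theta - alpha] negligible against [theta - z]. *)
Lemma pair_unit f : (size f < size phi)%N ->
  exists2 u, u \in one_unit v & ev f theta = ev f alpha * u.
Proof.
move=> fphi; have [->|f0] := eqVneq f 0.
  by exists 1; rewrite ?one_unit1 // !ev0 mul0r.
have [c [s [c0 fE fs]]] := ev_factor HL f0; rewrite !fE.
have {fs} : forall z, z \in s -> (deg iota z < deg iota alpha)%N.
  move=> z /fs /(deg_root HL f0) zf; rewrite -ltnS -(deg_minpoly HL phi_min).
  exact: leq_ltn_trans zf fphi.
elim: s {fE} => [|z s IH] sdeg; first by exists 1; rewrite ?one_unit1 // !big_nil !mulr1.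
have [|u uU uE] := IH; first by move=> w ws; apply: sdeg; rewrite inE ws orbT.
have [_ _ hz] := pair; have := hz z (sdeg z (mem_head _ _)).
(* [theta = z] is excluded: [theta - z] would have infinite value, which is strictly below
   nothing. *)
have [->|tz0] := eqVneq (theta - z) 0; first by rewrite val0 /vlt; case: (v _).
rewrite vlt_div // => tz.
(* The quotient is 1 minus [(theta - alpha) / (theta - z)], which lies in the maximal ideal. *)
have w1 : (alpha - z) / (theta - z) \in one_unit v.
  rewrite unfold_in; have -> : (alpha - z) / (theta - z) - 1 = - ((theta - alpha) / (theta - z)).
    by field.
  by rewrite -sub0r; apply: val_maxB => //; rewrite unfold_in val0.
exists (((alpha - z) / (theta - z))^-1 * u); first by apply: one_unitM => //; apply: one_unitV.
have az0 : alpha - z != 0.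
  by apply/eqP => az0; have := one_unit_val w1; rewrite az0 mul0r val0.
rewrite !big_cons mulrCA uE; field.
by rewrite az0 tz0.
Qed.

(** Each root [z] has degree below [deg theta], so by maximality [theta - z] has value at most that
    of [theta - alpha]. Then [alpha - z], the difference of these two, has value at least that of
    [theta - z]. *)
Lemma pair_le f : f != 0 -> (size f <= deg iota theta)%N ->
  vle (v (ev f theta)) (v (ev f alpha)).
Proof.
move=> f0 ftheta; have [c [s [c0 fE fs]]] := ev_factor HL f0; rewrite !fE.
have {fs} : forall z, z \in s -> (deg iota z < deg iota theta)%N.
  by move=> z /fs /(deg_root HL f0) zf; apply: leq_trans zf ftheta.
move=> sdeg; apply: vleM; first exact: vle_refl.
elim: s sdeg {fE} => [|z s IH] sdeg; first by rewrite !big_nil vle_refl.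
rewrite !big_cons; apply: vleM; last by apply: IH => w ws; apply: sdeg; rewrite inE ws orbT.
have [_ [_ hmax] _] := pair.
have hz : vle (v (theta - z)) (v (theta - alpha)).
  by apply: hmax; exists z => //; apply: sdeg; rewrite mem_head.
have := valD v (theta - z) (- (theta - alpha)).
rewrite Defs.valN /vmin hz.
by have -> : theta - z - (theta - alpha) = alpha - z by ring.
Qed.

Lemma pair_key_neq0 : pi != 0.
Proof.
apply/eqP => pi0; have [mdeg _ _] := pair; have [pmon _ _] := phi_min.
have := deg_root HL (monic_neq0 pmon) pi0.
by rewrite (deg_minpoly HL phi_min) ltnS leqNgt mdeg.
Qed.

(** [M] need not lie in [T]; instead [q(alpha)] is replaced by [q(theta)], at the cost of a factor
    of residue 1. *)
Lemma pair_lift x : M x -> exists u, u \in one_unit v /\ T (x * u).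
Proof.
move=> /(simple_extP HL phi_min)[q qphi ->]; have [u uU uE] := pair_unit qphi.
by exists u; split=> //; rewrite -uE; apply: simple_ext_ev.
Qed.

Lemma pair_value_group : value_group v M `<=` value_group v T.
Proof.
move=> g [x Mx vx]; have [u [uU Tu]] := pair_lift Mx.
by exists (x * u) => //; rewrite val_mul_unit // one_unit_val.
Qed.

Lemma pair_residue_field : residue_field v M `<=` residue_field v T.
Proof.
move=> _ [x [Mx xO] <-]; have [u [uU Tu]] := pair_lift Mx; have /one_unitP[uO u1] := uU.
exists (x * u); first by split=> //; apply: rpredM.
by rewrite residueM // u1 mulr1.
Qed.

(** As [pi] is algebraic over [K], two terms of a polynomial relation have equal value, so some
    positive multiple of the value of [pi] is the value of an element of [K]. [E] is the least
    multiple that works for [M]. *)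
Lemma pair_multiplier : exists E c, [/\ (0 < E)%N, M c, v c = v (pi ^+ E)
  & forall j, (0 < j < E)%N -> forall x, M x -> v x <> v (pi ^+ j)].
Proof.
pose P E := (0 < E)%N && `[< exists2 c, M c & v c = v (pi ^+ E) >].
have exP : exists E, P E.
  have [r r0 /rootP rpi] := HL.2 pi.
  have sr0 : \sum_(i < size r) iota r`_i * pi ^+ i = 0 by rewrite -(ev_coef iota _ (leqnn _)).
  (* The leading coefficient supplies the nonzero term that [sum_eq0_val] asks for. *)
  have lt_r : ((size r).-1 < size r)%N by rewrite prednK // size_poly_gt0.
  have [|j [k [jk xj0 vjk]]] := sum_eq0_val v (i := Ordinal lt_r) sr0.
    by rewrite mulf_neq0 ?expf_neq0 ?pair_key_neq0 // fmorph_eq0 -lead_coefE lead_coef_eq0.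
  have hP i1 i2 : (i1 < i2)%N -> iota r`_i1 * pi ^+ i1 != 0 ->
      v (iota r`_i1 * pi ^+ i1) = v (iota r`_i2 * pi ^+ i2) -> P (i2 - i1)%N.
    move=> i12 x10 vi; rewrite /P subn_gt0 i12; apply/asboolP.
    have x20 : iota r`_i2 * pi ^+ i2 != 0.
      by have [g vg] := val_neq0 v x10; apply: (@val_Some_neq0 _ _ v _ g); rewrite -vi.
    exists (iota r`_i1 / iota r`_i2).
      by apply: (subfield_div Msub); apply: simple_ext_iota.
    apply/val_eq_div; first by rewrite expf_neq0 // pair_key_neq0.
    move: vi => /val_eq_div -/(_ x20) <-; congr (v _).
    have e : pi ^+ i2 = pi ^+ i1 * pi ^+ (i2 - i1) by rewrite -exprD subnKC // ltnW.
    move: x20; rewrite e !mulf_eq0 !negb_or => /and3P[? ? ?].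
    by field; apply/and3P; split.
  have xk0 : iota r`_k * pi ^+ k != 0.
    by have [g vg] := val_neq0 v xj0; apply: (@val_Some_neq0 _ _ v _ g); rewrite -vjk.
  move: jk; rewrite neq_ltn => /orP[jk|kj].
    by exists (k - j)%N; apply: hP.
  by exists (j - k)%N; apply: hP.
case: (ex_minnP exP) => E /andP[E0 /asboolP[c Mc vc]] Emin.
exists E, c; split=> // j /andP[j0 jE] x Mx vx.
have /Emin : P j by rewrite /P j0; apply/asboolP; exists x.
by rewrite leqNgt jE.
Qed.

(** * The degree formula for a distinguished pair *)

Section Multiplier.
Variables (E : nat) (c : L).
Hypotheses (E0 : (0 < E)%N) (Mc : M c) (vc : v c = v (pi ^+ E)).
Hypothesis Emin : forall j, (0 < j < E)%N -> forall x, M x -> v x <> v (pi ^+ j).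

Let y := residue v (pi ^+ E / c).
Let pi0 := pair_key_neq0.

Let c0 : c != 0.
Proof.
have [g vpE] := val_neq0 v (expf_neq0 E pi0).
by apply: (@val_Some_neq0 _ _ v _ g); rewrite vc.
Qed.

Let vu : v (pi ^+ E / c) = Some 0. Proof. exact/val_eq_div. Qed.
Let uO : pi ^+ E / c \in val_ring v. Proof. exact: val_unit_ring. Qed.
Let y0 : y != 0. Proof. exact: residue_unit. Qed.

(** Stands in for the minimal polynomial of [y] over the residue field of [M], which is only a set:
    the degree of [y] is the largest such [N]. *)
Definition indep_powers N := forall d : 'I_N -> residue_type v,
  (forall j, residue_field v M (d j)) ->
  \sum_(j < N) d j * y ^+ j = 0 -> forall j, d j = 0.

Let Ssum N (f : nat -> {poly K}) := \sum_(i < N * E) ev (f i) alpha * pi ^+ i.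

Let Sval N (f : nat -> {poly K}) : indep_powers N -> forall i, (i < N * E)%N ->
  vle (v (Ssum N f)) (v (ev (f i) alpha * pi ^+ i)).
Proof.
move=> indN; apply: (val_expansion Msub pi0 E0 Mc vc Emin (a := fun i => ev (f i) alpha) indN).
by move=> i; apply: simple_ext_ev.
Qed.

Let Ssum_eq0 N (f : nat -> {poly K}) : indep_powers N -> Ssum N f = 0 ->
  forall i, (i < N * E)%N -> ev (f i) alpha = 0.
Proof.
move=> indN S0 i iN; have := Sval f indN iN; rewrite S0 val0.
case vi: (v _) => //= _; move/(val_infty v): vi => /eqP.
by rewrite mulf_eq0 (negbTE (expf_neq0 _ pi0)) orbF => /eqP.
Qed.

(** Passing from [theta] to [alpha] multiplies the terms by different units of residue 1. They merge
    into one such unit because no term has smaller value than the sum. *)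
Lemma pair_expansion N (f : nat -> {poly K}) : indep_powers N ->
  (forall i, (size (f i) < size phi)%N) ->
  exists2 u, u \in one_unit v & ev (\sum_(i < N * E) f i * phi ^+ i) theta
    = (\sum_(i < N * E) ev (f i) alpha * pi ^+ i) * u.
Proof.
move=> indN fs; rewrite -/(Ssum N f).
have /choice[u hu] i : exists u, u \in one_unit v /\ ev (f i) theta = ev (f i) alpha * u.
  by have [u uU e] := pair_unit (fs i); exists u.
have -> : ev (\sum_(i < N * E) f i * phi ^+ i) theta =
    \sum_(i < N * E) ev (f i) alpha * pi ^+ i * u i.
  by rewrite ev_sum; apply: eq_bigr => i _; rewrite evM evX (hu i).2 mulrAC.
have [S0|S0] := eqVneq (Ssum N f) 0.
  exists 1; first exact: one_unit1.
  by rewrite S0 mul0r big1 // => i _; rewrite (Ssum_eq0 indN S0) ?mul0r.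
eexists; last by rewrite mulrC; apply/esym/(divfK S0).
(* The quotient minus 1 is the sum of the terms [t_i (u_i - 1) / S], where [t_i / S] is in the
   valuation ring and [u_i - 1] in the maximal ideal. *)
rewrite unfold_in -(divff S0) -mulrBl /Ssum -sumrB mulr_suml.
apply: val_max_sum => i; rewrite -{2}[_ * pi ^+ i]mulr1 -mulrBr mulrAC.
apply: val_maxMl; last by have [] := hu i.
by rewrite -vle_div //; apply: Sval.
Qed.

(** Otherwise the minimal polynomial of [theta] has an expansion with [N * E] digits. Its value at
    [theta] is 0, so all digits vanish at [alpha], hence are zero. *)
Lemma indep_powers_bound N : indep_powers N ->
  (N * E * deg iota alpha <= deg iota theta)%N.
Proof.
move=> indN; rewrite leqNgt; apply/negP => lt.
have [p hp] := minpoly_exists HL theta; have sphi := deg_minpoly HL phi_min.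
have [||f [fs pE]] := @poly_expansion K phi p (N * E).
- by rewrite sphi ltnS deg_gt0.
- by rewrite sphi (deg_minpoly HL hp).
have [pmon ptheta _] := hp.
have [u uU uE] := pair_expansion indN fs.
have S0 : Ssum N f = 0.
  move: uE; rewrite -pE ptheta => /esym/eqP; rewrite mulf_eq0 => /orP[/eqP//|].
  by rewrite (negbTE (val_Some_neq0 (one_unit_val uU))).
have := monic_neq0 pmon; rewrite pE big1 ?eqxx // => i _.
by rewrite (minpoly_small phi_min (fs i) (Ssum_eq0 indN S0 (ltn_ord i))) mul0r.
Qed.

Lemma indep_powers_max : exists N, [/\ (0 < N)%N, indep_powers N & ~ indep_powers N.+1].
Proof.
pose P N := `[< indep_powers N >].
have P1 : P 1%N.
  by apply/asboolP => d _; rewrite big_ord1 expr0 mulr1 => d0 j; rewrite ord1.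
have Pmax N : P N -> (N <= deg iota theta)%N.
  move=> /asboolP/indep_powers_bound; apply: leq_trans.
  by rewrite -mulnA leq_pmulr // muln_gt0 E0 deg_gt0.
case: (ex_maxnP (ex_intro P 1%N P1) Pmax) => N /asboolP indN Nmax.
exists N; split=> //; first exact: Nmax P1.
by move=> /asboolP/Nmax; rewrite ltnn.
Qed.

Variable N : nat.
Hypotheses (N0 : (0 < N)%N) (indN : indep_powers N) (depN : ~ indep_powers N.+1).

Let ksub : is_subfield (residue_field v M).
Proof. exact: residue_field_subfield. Qed.

(** This is the minimal polynomial of [y]. Its constant term, at index [Ordinal N0], must be nonzero
    for the lift below to have a known value at [alpha]. *)
Lemma residue_relation : exists d : 'I_N -> residue_type v,
  [/\ forall j, residue_field v M (d j), y ^+ N + \sum_(j < N) d j * y ^+ j = 0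
    & d (Ordinal N0) != 0].
Proof.
have [d [kd dsum dnz]] : exists d : 'I_N.+1 -> residue_type v,
    [/\ forall j, residue_field v M (d j), \sum_(j < N.+1) d j * y ^+ j = 0
      & exists j, d j != 0].
  apply: contrapT => hn; apply: depN => d kd d0 j; apply/eqP/negPn/negP => dj.
  by apply: hn; exists d; split=> //; exists j.
have dN : d ord_max != 0.
  apply/eqP => dN; case: dnz => j; move: dsum; rewrite big_ord_recr /= dN mul0r addr0.
  move=> /(indN (fun j => kd _)) d0.
  case: (unliftP ord_max j) => [i ->|->]; last by rewrite dN eqxx.
  have -> : lift ord_max i = widen_ord (leqnSn N) i by apply: val_inj; exact: lift_max.
  by rewrite d0 eqxx.
exists (fun j => d (widen_ord (leqnSn N) j) / d ord_max); split.
- by move=> j; apply: (subfield_div ksub).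
- apply: (mulIf dN); rewrite mul0r -[RHS]dsum big_ord_recr /= mulrDl addrC mulrC.
  congr (_ + _); rewrite mulr_suml; apply: eq_bigr => j _.
  by rewrite mulrAC divfK.
- rewrite mulf_neq0 ?invr_eq0 //; apply/negP => /eqP d0.
  move: dsum; rewrite big_ord_recl.
  have -> : ord0 = widen_ord (leqnSn N) (Ordinal N0) by apply: val_inj.
  rewrite d0 mul0r add0r => dsum.
  (* With zero constant term, division by [y] leaves a relation among [N] powers whose top
     coefficient is still [d ord_max]. *)
  have ltN : (N.-1 < N)%N by rewrite prednK.
  have esum : \sum_(j < N) d (lift ord0 j) * y ^+ j = 0.
    apply: (mulIf y0); rewrite mul0r -[RHS]dsum mulr_suml; apply: eq_bigr => j _.
    by rewrite -mulrA -exprSr.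
  have := indN (fun j => kd (lift ord0 j)) esum (Ordinal ltN).
  have -> : lift ord0 (Ordinal ltN) = ord_max.
    by apply: val_inj; rewrite /= /bump /= add1n prednK.
  by move/eqP; rewrite (negbTE dN).
Qed.

Lemma pair_degree : deg iota theta = (N * E * deg iota alpha)%N.
Proof.
apply/eqP; rewrite eqn_leq (indep_powers_bound indN) andbT leqNgt; apply/negP => lt.
have [d [kd dsum d0]] := residue_relation.
have /choice[b hb] j : exists b, [/\ M b, b \in val_ring v & residue v b = d j].
  by have [b [Mb bO] e] := kd j; exists b.
have /choice[f hf] (j : 'I_N) : exists f : {poly K},
    (size f < size phi)%N /\ ev f alpha = b j * c ^+ (N - j).
  have /(simple_extP HL phi_min)[f fs e] : M (b j * c ^+ (N - j)).
    by apply: (subfieldM Msub); [have [] := hb j|exact: subfieldX _ Mc].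
  by exists f.
have /choice[u hu] j : exists u, u \in one_unit v /\ ev (f j) theta = ev (f j) alpha * u.
  by have [u uU e] := pair_unit (hf j).1; exists u.
(* The lift is homogenized: [f j] takes the value [b j * c ^+ (N - j)] at [alpha], so that
   [g(theta) / c ^+ N] has as residue the minimal polynomial at [y]. *)
pose g := phi ^+ (N * E) + \sum_(j < N) f j * phi ^+ (j * E).
have sphi := deg_minpoly HL phi_min; have phia : ev phi alpha = 0 by have [] := phi_min.
have gs : (size g <= deg iota theta)%N.
  apply: leq_trans lt; apply: leq_trans (size_polyD _ _) _; rewrite geq_max.
  apply/andP; split.
    by apply: leq_trans (size_poly_exp_leq _ _) _; rewrite sphi /= mulnC.
  apply: leq_trans (size_sum _ _ _) _; apply/bigmax_leqP => j _.
  apply: leq_trans (size_polyMleq _ _) _.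
  have := size_poly_exp_leq phi (j * E); have [] := hf j; rewrite sphi /= ltnS => h1 _ h2.
  rewrite -subn1 leq_subLR add1n; apply: leqW.
  apply: leq_trans (leq_add h1 h2) _; rewrite addnS ltnS -mulnS mulnC leq_mul //.
  apply: leq_trans (leq_mul (ltn_ord j) (leqnn E)).
  by rewrite mulSn -{1}[(j * E)%N]add0n ltn_add2r.
have ga : ev g alpha = b (Ordinal N0) * c ^+ N.
  rewrite evD evX phia expr0n muln_eq0 !gtn_eqF // add0r ev_sum (bigD1 (Ordinal N0)) //=.
  rewrite mul0n expr0 mulr1 (hf _).2 subn0 big1 ?addr0 // => j j0.
  rewrite evM evX phia expr0n muln_eq0 (gtn_eqF E0) orbF.
  by rewrite (negbTE (j0 : (j : nat) != 0%N)) mulr0.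
have cN0 : c ^+ N != 0 by rewrite expf_neq0.
have [Mb0 bO0 b0] := hb (Ordinal N0).
(* The nonzero constant term makes [b 0] a unit, so [g(alpha)] has exactly the value of [c ^+ N]. *)
have vb0 : v (b (Ordinal N0)) = Some 0.
  by apply/eqP/negPn; rewrite val_unitE // -residue_eq0 // b0.
have g0 : g != 0.
  apply: contraNneq cN0 => g0; move/eqP: ga; rewrite g0 ev0 eq_sym mulf_eq0.
  by rewrite (negbTE (val_Some_neq0 vb0)).
have := pair_le g0 gs; rewrite ga mulrC val_mul_unit //.
(* It remains to contradict [pair_le]: [g(theta) / c ^+ N] has residue 0. *)
apply/negP; rewrite -/(vlt _ _) vlt_div //.
have -> : ev g theta / c ^+ N = (pi ^+ E / c) ^+ N +
    \sum_(j < N) b j * u j * (pi ^+ E / c) ^+ j.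
  rewrite evD evX -/pi mulrDl; congr (_ + _).
    by rewrite expr_div_n mulnC exprM.
  rewrite ev_sum mulr_suml; apply: eq_bigr => j _.
  rewrite evM evX -/pi (hu j).2 (hf j).2 expr_div_n [(j * E)%N]mulnC exprM.
  have -> : c ^+ N = c ^+ (N - j) * c ^+ j by rewrite -exprD subnK // ltnW.
  move: (pi ^+ E) => q.
  by field; rewrite !expf_neq0.
have termO j : b j * u j * (pi ^+ E / c) ^+ j \in val_ring v.
  have [_ bO _] := hb j; have /one_unitP[uO' _] := (hu j).1.
  by rewrite rpredM ?rpredX // rpredM.
rewrite -residue_eq0; last by rewrite rpredD ?rpredX // rpred_sum.
rewrite residueD ?rpredX ?rpred_sum // residueX // residue_sum // -/y.
apply/eqP; rewrite -[RHS]dsum; congr (_ + _); apply: eq_bigr => j _.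
have [_ bO bd] := hb j; have /one_unitP[uO' u1] := (hu j).1.
rewrite residueM; [|exact: rpredM|exact: rpredX].
by rewrite residueM // bd u1 mulr1 residueX.
Qed.

(** * The value group and the residue field of [K(theta)] *)

(** By the degree formula, [N * E] digits suffice to expand any polynomial of degree below
    [deg theta]. *)
Lemma pair_element x : T x -> exists (a : nat -> L) u,
  [/\ forall i, M (a i), u \in one_unit v, x = (\sum_(i < N * E) a i * pi ^+ i) * u
    & forall i, (i < N * E)%N -> vle (v x) (v (a i * pi ^+ i))].
Proof.
have [p hp] := minpoly_exists HL theta; have sphi := deg_minpoly HL phi_min.
move=> /(simple_extP HL hp)[q qp ->].
have [||f [fs qE]] := @poly_expansion K phi q (N * E).
- by rewrite sphi ltnS deg_gt0.
- by rewrite sphi -pair_degree -ltnS -(deg_minpoly HL hp).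
have [u uU uE] := pair_expansion indN fs.
exists (fun i => ev (f i) alpha), u; split=> //.
- by move=> i; apply: simple_ext_ev.
- by rewrite qE.
- by move=> i iN; rewrite qE uE (val_mul_unit _ (one_unit_val uU)); exact: Sval.
Qed.

(** If no term had the value of [x], all terms divided by [x] would lie in the maximal ideal; but
    they add up to [u^-1], a unit. *)
Lemma pair_value x g : T x -> v x = Some g ->
  exists a i, M a /\ v (a * pi ^+ i) = Some g.
Proof.
move=> Tx vx; have [a [u [Ma uU xE xmin]]] := pair_element Tx.
apply: contrapT => hn; have x0 := val_Some_neq0 vx.
have : u^-1 \in val_max v.
  have -> : u^-1 = \sum_(i < N * E) a i * pi ^+ i / x.
    rewrite -mulr_suml [in X in _ / X]xE invfM mulrA divff ?mul1r //.
    by apply: contraNneq x0 => S0; rewrite xE S0 mul0r.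
  apply: val_max_sum => i; have iO := xmin i (ltn_ord i); rewrite vle_div // in iO.
  rewrite -val_unitE //; apply/eqP => /(val_eq_div v _ x0) e.
  by apply: hn; exists (a i), i; rewrite e.
by rewrite unfold_in (one_unit_val (one_unitV uU)) /vlt vle_refl.
Qed.

(** Terms whose exponent is not a multiple of [E] cannot have value 0, so they vanish in the residue
    field. *)
Lemma pair_residue w : residue_field v T w ->
  exists2 d : 'I_N -> residue_type v, (forall j, residue_field v M (d j))
    & w = \sum_(j < N) d j * y ^+ j.
Proof.
move=> [x [Tx xO] <-]; have [a [u [Ma uU xE xmin]]] := pair_element Tx.
have aO i : (i < N * E)%N -> a i * pi ^+ i \in val_ring v.
  by move=> iN; apply: vle_trans xO (xmin i iN).
have rN j s : (j < N)%N -> (s < E)%N -> (j * E + s < N * E)%N.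
  by move=> jN sE; apply: leq_trans (leq_mul jN (leqnn E)); rewrite mulSn addnC ltn_add2r.
have /one_unitP[uO' u1] := uU.
have dO j : (j < N)%N -> a (j * E)%N * c ^+ j \in val_ring v.
  move=> jN; have := aO _ (rN j 0%N jN E0); rewrite (power_split _ _ _ _ _ c0) addn0 expr0 mulr1.
  by rewrite !unfold_in val_mul_unit // val_unitX.
exists (fun j => residue v (a (j * E)%N * c ^+ j)) => [j|].
  exists (a (j * E)%N * c ^+ j) => //; split; last exact: dO.
  by apply: (subfieldM Msub) => //; apply: (subfieldX Msub).
rewrite xE residueM // ?u1 ?mulr1; last by apply: rpred_sum => i _; apply: aO.
rewrite residue_sum => [|i _]; last exact: aO.
rewrite (sum_ord_mul (fun i => residue v (a i * pi ^+ i))); apply: eq_bigr => j _.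
rewrite (bigD1 (Ordinal E0)) //= big1 ?addr0 => [|s s0].
  have := power_split (a (j * E)%N) pi E j 0 c0; rewrite addn0 => ->.
  by rewrite expr0 mulr1 residueM ?residueX ?rpredX // dO.
have sO := aO _ (rN j s (ltn_ord j) (ltn_ord s)).
apply/eqP; rewrite residue_eq0 // -val_unitE //; apply: contraNneq s0 => vs.
have a0 : a (j * E + s)%N != 0.
  by have := val_Some_neq0 vs; rewrite mulf_eq0 negb_or => /andP[].
(* A term of value 0 is compared with [1 * pi ^+ 0], which forces [s = 0]. *)
have : v (a (j * E + s)%N * c ^+ j * pi ^+ s) = v (1 * pi ^+ 0).
  rewrite expr0 mulr1 Defs.val1 -vs (power_split _ _ _ _ _ c0) [in RHS]val_mul_unit //.
  exact: val_unitX.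
move=> /(power_value_class Msub pi0 Emin) h; apply/eqP/val_inj; apply: h => //.
- by apply: (subfieldM Msub) => //; apply: (subfieldX Msub).
- exact: (subfield1 Msub).
- by rewrite mulf_neq0 // expf_neq0.
- exact: oner_neq0.
Qed.

(** [c] lies in [M], not necessarily in [T]; [c * u] lies in [T] and gives the same residue. *)
Lemma pair_residue_gen : residue_field v T y.
Proof.
have [u [uU Tu]] := pair_lift Mc; have /one_unitP[uVO uV1] := one_unitV uU.
exists (pi ^+ E / (c * u)).
  split; first by apply: (subfield_div Tsub) => //;
    apply: (subfieldX Tsub); apply: simple_ext_ev.
  by rewrite invfM mulrA /=; apply: rpredM.
by rewrite invfM mulrA residueM // uV1 mulr1.
Qed.

Lemma pair_residue_adjoin : residue_field v T = adjoin (residue_field v M) y.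
Proof.
apply/seteqP; split=> [w /pair_residue[d kd ->]|].
  have asub := adjoin_subfield (residue_field v M) y.
  apply: (subfield_sum asub) => j; apply: (subfieldM asub); first exact: adjoin_sub.
  by apply: (subfieldX asub); apply: adjoin_gen.
apply: adjoin_min; [exact: residue_field_subfield|exact: pair_residue_field|].
exact: pair_residue_gen.
Qed.

Lemma pair_residue_basis :
  is_basis (residue_field v M) (residue_field v T) (fun j : 'I_N => y ^+ j).
Proof.
split=> [j|w /pair_residue[d kd ->]|]; [|by exists d|exact: indN].
by apply: subfieldX; [exact: residue_field_subfield|exact: pair_residue_gen].
Qed.

Variable gamma : G.
Hypothesis vpi : v pi = Some gamma.

Lemma pair_value_group_eq : value_group v T =
  [set a + gamma *~ m | a in value_group v M & m in [set: int]].
Proof.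
have Tgr := value_group_subgroup v Tsub.
have vX i : v (pi ^+ i) = Some (gamma *+ i) by rewrite valX vpi vmuln_Some.
apply/seteqP; split=> [g [x Tx vx]|_ [a Ma [m _ <-]]].
  have [a [i [Ma]]] := pair_value Tx vx; rewrite Defs.valM vX.
  case va: (v a) => [h|] //= [<-].
  by exists h; [exists a|exists i%:Z].
apply: (subgroup_setD Tgr); first exact: pair_value_group.
by apply: (subgroup_setMz _ Tgr); exists pi => //; apply: simple_ext_ev.
Qed.

Lemma pair_transversal :
  coset_transversal (value_group v T) (value_group v M) (fun i : 'I_E => gamma *+ i).
Proof.
have Mgr := value_group_subgroup v Msub.
have vX i : v (pi ^+ i) = Some (gamma *+ i) by rewrite valX vpi vmuln_Some.
split=> [i|g [x Tx vx]|i j].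
- exists (pi ^+ i); last exact: vX.
  by apply: (subfieldX Tsub); apply: simple_ext_ev.
- have [a [i [Ma]]] := pair_value Tx vx; rewrite Defs.valM vX.
  case va: (v a) => [h|] //= [<-].
  have iE : (i %% E < E)%N by rewrite ltn_mod.
  (* Full multiples of [E] in the exponent are moved into [M] through powers of [c]. *)
  exists (Ordinal iE) => /=; exists (a * c ^+ (i %/ E)).
    by apply: (subfieldM Msub) => //; apply: (subfieldX Msub).
  rewrite Defs.valM va valX vc vX vmuln_Some /=; congr Some.
  by rewrite {2}(divn_eq i E) mulrnDr -mulrnA mulnC addrA addrK.
- move=> [a Ma va]; have a0 := val_Some_neq0 va; apply/esym/val_inj.
  apply: (power_value_class Msub pi0 Emin Ma (subfield1 Msub) a0 (oner_neq0 _)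
    (ltn_ord j) (ltn_ord i)).
  by rewrite !Defs.valM va !vX Defs.val1 /= subrK add0r.
Qed.

End Multiplier.
End DistinguishedPair.

(** * Passage along the chain *)

Theorem theorem5p15 (K L : fieldType) (iota : {rmorphism K -> L})
    (HL : is_algebraic_closure iota)
    (G : orderedGroupType) (v : valuation K G) (vbar : valuation L G)
    (Hext : forall a : K, vbar (iota a) = v a)
    (n : nat) (theta : L) (t : nat -> L) (phi : nat -> {poly K})
    (Hphi : forall i, (i <= n)%N -> is_minpoly iota (t i) (phi i))
    (Hchain : saturated_distinguished_chain iota vbar theta n t) :
  let Gamma i := value_group vbar (simple_ext iota (t i)) in
  let k i := residue_field vbar (simple_ext iota (t i)) in
  let Gamma_v := value_group v setT in
  let k_v := residue_field vbar (range iota) in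
  ((forall i, (1 <= i <= n)%N ->
      exists2 g : G, vbar (ev iota (phi i.-1) (t i)) = Some g
        & Gamma i = [set a + g *~ m | a in Gamma i.-1 & m in [set: int]])
   /\ Gamma 0%N = Gamma_v)
  /\ ((forall i, (1 <= i <= n)%N ->
      exists2 e : nat,
        least_multiplier iota vbar (t i.-1) (t i) (phi i.-1) e
        & forall h : {poly K},
            value_multiple iota vbar (t i.-1) (t i) (phi i.-1) e h ->
            k i = adjoin (k i.-1)
                    (residue vbar (ev iota (phi i.-1) (t i) ^+ e
                                   / ev iota h (t i.-1))))
      /\ k 0%N = k_v)
  /\ (forall i, (i <= n)%N ->
      deg iota (t i)
      = (group_index (Gamma i) Gamma_v * field_degree k_v (k i))%N).
Proof.
case: Hchain => _ Hpair t0 Gamma k Gamma_v k_v.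
have GvE : Gamma_v = value_group vbar (range iota).
  apply/seteqP; split=> [g [a _ va]|g [_ [a _ <-] va]].
    by exists (iota a); [exists a|rewrite Hext].
  by exists a; rewrite // -Hext.
have K0 : simple_ext iota (t 0%N) = range iota by apply: simple_ext_base.
have lt_min i : (i < n)%N -> is_minpoly iota (t i) (phi i).
  by move=> /ltnW; apply: Hphi.
have Ksub := range_subfield iota.
have ksub := residue_field_subfield vbar Ksub.
have Gsub := value_group_subgroup vbar Ksub.
split; [split|split; [split|]].
- case=> // i lt_in; have pair := Hpair i lt_in; have phi_min := lt_min i lt_in.
  have [E [c [E0 Mc vc Emin]]] := pair_multiplier HL pair phi_min.
  have [N [N0 indN depN]] := indep_powers_max HL pair phi_min E0 Mc vc Emin.
  have [g vg] := val_neq0 vbar (pair_key_neq0 HL pair phi_min).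
  exists g => //.
  exact: (pair_value_group_eq HL pair phi_min E0 Mc vc Emin N0 indN depN vg).
- by rewrite GvE /Gamma K0.
- case=> // i lt_in; have pair := Hpair i lt_in; have phi_min := lt_min i lt_in.
  have [E [c [E0 Mc vc Emin]]] := pair_multiplier HL pair phi_min.
  exists E; first split=> //=.
  + have [h hs cE] := simple_extP HL phi_min Mc; exists h.
    rewrite /value_multiple -cE; split=> //.
      by rewrite vc valX.
    have [g vg] := val_neq0 vbar (expf_neq0 E (pair_key_neq0 HL pair phi_min)).
    by exists g; [exists c => //; rewrite vc|rewrite vc].
  + move=> e' e'0 [h [_ vh _]]; rewrite leqNgt; apply/negP => lt_e'.
    have Mh : simple_ext iota (t i) (ev iota h (t i)) by exact: simple_ext_ev.
    have e'E : (0 < e' < E)%N by rewrite e'0.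
    by apply: (Emin _ e'E _ Mh); rewrite valX vh.
  + move=> h [_ vh _].
    have Mh : simple_ext iota (t i) (ev iota h (t i)) by exact: simple_ext_ev.
    have vh' : vbar (ev iota h (t i)) = vbar (ev iota (phi i) (t i.+1) ^+ E) by rewrite valX.
    (* The least multiplier is kept, but [h(alpha)] replaces [c]; this changes [y], so [N] is chosen
       again. *)
    have [N [N0 indN depN]] := indep_powers_max HL pair phi_min E0 Mh vh' Emin.
    exact: (pair_residue_adjoin HL pair phi_min E0 Mh vh' Emin N0 indN depN).
- by rewrite /k K0.
(* The induction carries representatives and a basis rather than the two numbers: these combine at
   each step by [transversal_trans] and [basis_tower]. *)
suff tower i : (i <= n)%N -> exists (I : finType) (r : I -> G) (N : nat)
    (b : 'I_N -> residue_type vbar),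
    [/\ coset_transversal (Gamma i) Gamma_v r, is_basis k_v (k i) b
      & deg iota (t i) = (#|I| * N)%N].
  move=> i /tower[I [r [N [b [hr hb ->]]]]].
  by rewrite (group_indexE _ hr) ?(field_degreeE ksub hb) // GvE.
elim: i => [_|i IH lt_in].
  exists 'I_1, (fun=> 0), 1%N, (fun=> 1); rewrite card_ord muln1 /Gamma /k K0 -GvE; split.
  - split=> [_|a Ga|i j _]; [by rewrite GvE; apply: Gsub.1| |by rewrite !ord1].
    by exists ord0; rewrite subr0.
  - exact: basis1.
  - by rewrite /deg K0; apply: (field_degreeE Ksub (basis1 Ksub)).
have [I [r [N1 [b1 [hr hb1 di]]]]] := IH (ltnW lt_in).
have pair := Hpair i lt_in; have phi_min := lt_min i lt_in.
have [E [c [E0 Mc vc Emin]]] := pair_multiplier HL pair phi_min.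
have [N [N0 indN depN]] := indep_powers_max HL pair phi_min E0 Mc vc Emin.
have [g vg] := val_neq0 vbar (pair_key_neq0 HL pair phi_min).
have hs := pair_transversal HL pair phi_min E0 Mc vc Emin N0 indN depN vg.
have hb2 := pair_residue_basis HL pair phi_min E0 Mc vc Emin N0 indN depN.
have Xsub j := simple_ext_subfield iota (t j).
have k_mono : k_v `<=` k i.
  by move=> _ [x [Kx xO] <-]; exists x => //; split=> //; apply: simple_ext_range.
have G_mono : Gamma_v `<=` Gamma i.
  by rewrite GvE => h [x Kx vx]; exists x => //; apply: simple_ext_range.
have [b hb] := basis_tower (residue_field_subfield vbar (Xsub i))
  (residue_field_subfield vbar (Xsub i.+1)) k_mono
  (pair_residue_field HL pair phi_min) hb1 hb2.
have ht := transversal_trans (value_group_subgroup vbar (Xsub i))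
  (value_group_subgroup vbar (Xsub i.+1)) G_mono
  (pair_value_group HL pair phi_min) hr hs.
exists (I * 'I_E)%type; do 3!eexists; split; [exact: ht|exact: hb|].
rewrite card_prod card_ord (pair_degree HL pair phi_min E0 Mc vc Emin N0 indN depN) di.
by ring.
Qed.
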